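(* Let $q_1,q_2\geq 2$, $m_1,m_2\geq 1$ and $l_1,l_2$ be integers such that $\gcd(q_1,q_2)=1$, $\gcd(m_1,q_1-1)=1$ and $\gcd(m_2,q_2-1)=1$. Let $1<c<18/17$. Then there exists $\varepsilon>0$ such that for $x\geq 1$ \[ \left|\{n\leq x:\ s_{q_1}(\lfloor n^c\rfloor)\equiv l_1 \bmod m_1\ \text{and}\ s_{q_2}(\lfloor n^c\rfloor)\equiv l_2\bmod m_2\}\right|=\frac{x}{m_1m_2}+O\left(x^{1-\varepsilon}\right), \] where $n$ ranges over positive integers.
   Context: For an integer $q\geq 2$, $s_q(n)$ denotes the sum of the digits of the nonnegative integer $n$ in base $q$; $\lfloor\cdot\rfloor$ is the floor function. *)

(* Defs.v *)
From Stdlib Require Import Reals ZArith Arith List.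
Open Scope R_scope.

(* Sum of base-q digits of n (fuel n suffices since q >= 2 strictly decreases n). *)
Fixpoint digit_sum_aux (fuel q n : nat) : nat :=
  match fuel with
  | O => O
  | S f => if Nat.eqb n 0 then O else (n mod q + digit_sum_aux f q (n / q))%nat
  end.

Definition digit_sum (q n : nat) : nat := digit_sum_aux n q n.

(* floor function on reals: up r is the unique integer with r < up r <= r + 1 *)
Definition Rfloor (r : R) : Z := (up r - 1)%Z.

(* floor(n^c) as a natural number (n >= 1 so n^c > 0) *)
Definition floor_pow (n : nat) (c : R) : nat := Z.to_nat (Rfloor (Rpower (INR n) c)).

Definition congZ (s : nat) (l : Z) (m : nat) : Prop :=
  Z.modulo (Z.of_nat s - l) (Z.of_nat m) = 0%Z.

Definition congZb (s : nat) (l : Z) (m : nat) : bool :=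
  Z.eqb (Z.modulo (Z.of_nat s - l) (Z.of_nat m)) 0%Z.

Definition count_set (q1 q2 m1 m2 : nat) (l1 l2 : Z) (c x : R) : nat :=
  length (filter (fun n => andb (congZb (digit_sum q1 (floor_pow n c)) l1 m1)
                                (congZb (digit_sum q2 (floor_pow n c)) l2 m2))
                 (seq 1 (Z.to_nat (Rfloor x)))).

(* Main.v *)
(* Write y = n^c.  Pairs (n, n+k) with k small are compared: by the variance form
   of van der Corput's inequality it suffices that the two digit sums of
   floor((n+k)^c) agree with those of floor(n^c), modulo m1 and m2, for a
   proportion 1/(m1 m2) of the n.  Since (n+k)^c - n^c has size about n^(c-1), the
   difference r of the two integer parts changes only digits below Q1 = q1^a and
   Q2 = q2^b, both slightly larger than n^(c-1), for almost all n.  On windows where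
   r is nearly constant, n^c is equidistributed modulo Q1 Q2 on a fine scale: again
   by a second moment, this reduces to the monotone sequences (n+h)^c - n^c, and
   there is room as long as 5c < 6.  The Chinese remainder theorem then separates
   the two bases, and for a single base q the deviation of s(m+r) - s(m) from uniform
   distribution modulo M contracts by a fixed factor with each block of digits of r
   equal to q, which saves a power of n on average over r. *)
Require Import Defs.
From Stdlib Require Import Reals ZArith Arith List.
From Stdlib Require Import Lia Lra Bool.
Open Scope R_scope.

(** * Finite sums and the second moment *)

(** Correlations are only ever bounded from above. In [second_moment] the masses have an exactly
    known total, so an upper bound for the mean square already bounds the variance. Doubtful events
    (a carry out of the truncated digits, a fractional part near a threshold, an extra unit in an
    integer part) may therefore all be counted as successes, and elementary counting suffices. The
    window length is under two opposite demands: over a window (n+k)^c - n^c may move by at most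
    1/P, so that one r serves it up to a carry, and yet n^c must fill the residues modulo Q1 Q2 at
    scale 1/P^2. One parameter P, a small power of N, measures all relative losses: the range of k,
    the smoothing length, the resolution, the variation of the curvature. A relative loss 1/P in the
    correlations becomes 1/sqrt P after the inner second moment and P^(-1/4) after the outer one.
    The conditions gcd(m, q-1) = 1 serve to make q-1 a generator modulo m: trading t digits q-1 for
    a single 1 then reaches every residue. *)

Fixpoint rsum (n : nat) (f : nat -> R) : R :=
  match n with
  | O => 0
  | S n' => rsum n' f + f n'
  end.

Definition indic (b : bool) : R := if b then 1 else 0.

Lemma indic_bounds (b : bool) : 0 <= indic b <= 1.
Proof. destruct b; simpl; lra. Qed.

Lemma indic_le (a b : bool) : (a = true -> b = true) -> indic a <= indic b.
Proof.
  intros H; destruct a, b; simpl; try lra; discriminate (H eq_refl).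
Qed.

Lemma indic_andb (a b : bool) : indic (a && b) = indic a * indic b.
Proof. destruct a, b; simpl; lra. Qed.

Lemma indic_orb_le (a b : bool) : indic (a || b) <= indic a + indic b.
Proof. destruct a, b; simpl; lra. Qed.

Lemma rsum_ext (n : nat) (f g : nat -> R) :
  (forall i, (i < n)%nat -> f i = g i) -> rsum n f = rsum n g.
Proof.
  induction n as [|n IH]; intros H; simpl; [reflexivity|].
  rewrite IH by (intros; apply H; lia). rewrite H by lia. reflexivity.
Qed.

Lemma rsum_le (n : nat) (f g : nat -> R) :
  (forall i, (i < n)%nat -> f i <= g i) -> rsum n f <= rsum n g.
Proof.
  induction n as [|n IH]; intros H; simpl; [lra|].
  assert (rsum n f <= rsum n g) by (apply IH; intros; apply H; lia).
  assert (f n <= g n) by (apply H; lia). lra.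
Qed.

Lemma rsum_const (n : nat) (a : R) : rsum n (fun _ => a) = INR n * a.
Proof.
  induction n as [|n IH]; [simpl; lra|].
  rewrite S_INR; simpl rsum; rewrite IH; ring.
Qed.

Lemma rsum_nonneg (n : nat) (f : nat -> R) :
  (forall i, (i < n)%nat -> 0 <= f i) -> 0 <= rsum n f.
Proof.
  intros H. replace 0 with (rsum n (fun _ => 0)) by (rewrite rsum_const; ring).
  apply rsum_le; exact H.
Qed.

Lemma rsum_le_const (n : nat) (f : nat -> R) (a : R) :
  (forall i, (i < n)%nat -> f i <= a) -> rsum n f <= INR n * a.
Proof. intros H. rewrite <- rsum_const. apply rsum_le; exact H. Qed.

Lemma rsum_plus (n : nat) (f g : nat -> R) :
  rsum n (fun i => f i + g i) = rsum n f + rsum n g.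
Proof. induction n as [|n IH]; simpl; [lra|]. rewrite IH; ring. Qed.

Lemma rsum_minus (n : nat) (f g : nat -> R) :
  rsum n (fun i => f i - g i) = rsum n f - rsum n g.
Proof. induction n as [|n IH]; simpl; [lra|]. rewrite IH; ring. Qed.

Lemma rsum_scal (n : nat) (a : R) (f : nat -> R) :
  rsum n (fun i => a * f i) = a * rsum n f.
Proof. induction n as [|n IH]; simpl; [lra|]. rewrite IH; ring. Qed.

Lemma rsum_swap (n m : nat) (f : nat -> nat -> R) :
  rsum n (fun i => rsum m (fun j => f i j)) = rsum m (fun j => rsum n (fun i => f i j)).
Proof.
  induction n as [|n IH]; simpl.
  - rewrite rsum_const; ring.
  - rewrite IH, <- rsum_plus. reflexivity.
Qed.

Lemma rsum_app (n m : nat) (f : nat -> R) :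
  rsum (n + m) f = rsum n f + rsum m (fun i => f (n + i)%nat).
Proof.
  induction m as [|m IH]; simpl.
  - rewrite Nat.add_0_r; ring.
  - rewrite Nat.add_succ_r; simpl; rewrite IH; ring.
Qed.

Lemma rsum_prod (a b : nat) (f : nat -> R) :
  rsum (a * b) f = rsum a (fun i => rsum b (fun j => f (i * b + j)%nat)).
Proof.
  induction a as [|a IH]; simpl; [reflexivity|].
  rewrite Nat.add_comm, rsum_app, IH. reflexivity.
Qed.

Lemma rsum_single (n a : nat) (f : nat -> R) :
  (a < n)%nat -> rsum n (fun i => indic (Nat.eqb a i) * f i) = f a.
Proof.
  intros Ha. replace n with (a + (1 + (n - a - 1)))%nat by lia.
  rewrite !rsum_app; simpl.
  assert (H0 : forall m s, (forall i, (i < m)%nat -> (s i <> a)) ->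
    rsum m (fun i => indic (Nat.eqb a (s i)) * f (s i)) = 0).
  { intros m s Hs. rewrite (rsum_ext _ _ (fun _ => 0)).
    - rewrite rsum_const; ring.
    - intros i Hi. specialize (Hs i Hi).
      destruct (Nat.eqb_spec a (s i)); [congruence|]; simpl; ring. }
  rewrite (H0 a (fun i => i)) by (intros; lia).
  rewrite (H0 (n - a - 1)%nat (fun i => (a + S i)%nat)) by (intros; lia).
  rewrite Nat.add_0_r, Nat.eqb_refl; simpl; ring.
Qed.

Lemma rsum_indic_single (n a : nat) :
  (a < n)%nat -> rsum n (fun i => indic (Nat.eqb a i)) = 1.
Proof.
  intros Ha. rewrite <- (rsum_single n a (fun _ => 1) Ha).
  apply rsum_ext; intros; ring.
Qed.

Lemma rsum_indic_unique (n : nat) (p : nat -> bool) :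
  (forall i j, (i < n)%nat -> (j < n)%nat -> p i = true -> p j = true -> i = j) ->
  rsum n (fun i => indic (p i)) <= 1.
Proof.
  induction n as [|n IH]; intros H; simpl; [lra|].
  destruct (p n) eqn:Hn; simpl.
  - rewrite (rsum_ext _ _ (fun _ => 0)).
    + rewrite rsum_const; lra.
    + intros i Hi. destruct (p i) eqn:Hp; [|reflexivity].
      specialize (H i n ltac:(lia) ltac:(lia) Hp Hn). lia.
  - assert (rsum n (fun i => indic (p i)) <= 1) by (apply IH; intros; apply H; auto; lia). lra.
Qed.

(** The offset [s] lets windows around a moving centre be expressed without truncated
    subtraction. *)
Lemma rsum_indic_range (n s a L : nat) :
  rsum n (fun i => indic (Nat.leb a (i + s) && Nat.ltb (i + s) (a + L))) <= INR L.
Proof.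
  induction L as [|L IH].
  - rewrite (rsum_ext _ _ (fun _ => 0)).
    + rewrite rsum_const; simpl; lra.
    + intros i _. destruct (Nat.leb_spec a (i + s)), (Nat.ltb_spec (i + s) (a + 0)); simpl; try lra; lia.
  - rewrite S_INR.
    apply Rle_trans with (rsum n (fun i => indic (Nat.leb a (i + s) && Nat.ltb (i + s) (a + L)) +
       indic (Nat.eqb (i + s) (a + L)))).
    + apply rsum_le; intros i _.
      destruct (Nat.leb_spec a (i + s)), (Nat.ltb_spec (i + s) (a + L)),
        (Nat.ltb_spec (i + s) (a + S L)), (Nat.eqb_spec (i + s) (a + L)); simpl; try lra; lia.
    + rewrite rsum_plus.
      assert (rsum n (fun i => indic (Nat.eqb (i + s) (a + L))) <= 1).
      { apply rsum_indic_unique; intros i j _ _ Hi Hj.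
        apply Nat.eqb_eq in Hi, Hj. lia. }
      lra.
Qed.

Lemma rsum_indic_mod (G s a : nat) : (0 < G)%nat ->
  rsum G (fun r => indic (Nat.eqb ((r + s) mod G) a)) <= 1.
Proof.
  intros HG. apply rsum_indic_unique; intros i j Hi Hj H1 H2.
  apply Nat.eqb_eq in H1, H2. rewrite <- H2 in H1.
  pose proof (Nat.div_mod_eq (i + s) G). pose proof (Nat.div_mod_eq (j + s) G).
  assert ((i + s) / G = (j + s) / G)%nat by nia. lia.
Qed.

Lemma rsum_abs (n : nat) (f : nat -> R) : Rabs (rsum n f) <= rsum n (fun i => Rabs (f i)).
Proof.
  induction n as [|n IH]; simpl; [rewrite Rabs_R0; lra|].
  eapply Rle_trans; [apply Rabs_triang|]. lra.
Qed.

(** Cauchy-Schwarz against a constant, read off from the nonnegative sum of squared deviations from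
    the mean [a]. *)
Lemma rsum_sqr_le (n : nat) (f : nat -> R) :
  rsum n f ^ 2 <= INR n * rsum n (fun i => f i ^ 2).
Proof.
  destruct n as [|n]; [simpl; lra|].
  set (m := S n). assert (Hm : 0 < INR m) by (apply lt_0_INR; unfold m; lia).
  set (a := rsum m f / INR m).
  assert (H : 0 <= rsum m (fun i => (f i - a) ^ 2)).
  { apply rsum_nonneg; intros; apply pow2_ge_0. }
  rewrite (rsum_ext _ _ (fun i => f i ^ 2 - (2 * a) * f i + a ^ 2)) in H by (intros; ring).
  rewrite rsum_plus, rsum_minus, rsum_scal, rsum_const in H.
  assert (Ha : rsum m f = a * INR m) by (unfold a; field; lra).
  rewrite Ha in *. nra.
Qed.

Lemma rsum_mul (n m : nat) (f g : nat -> R) :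
  rsum n f * rsum m g = rsum n (fun i => rsum m (fun j => f i * g j)).
Proof.
  rewrite Rmult_comm, <- rsum_scal. apply rsum_ext; intros.
  rewrite rsum_scal; ring.
Qed.

(* Van der Corput's inequality in its counting form: the average of [F] over a
   long range is compared with averages over short blocks of length [J], whose
   variance over the [G] classes is a sum of correlations. *)
Lemma second_moment (T J G : nat) (A : R) (F Rem : nat -> nat -> R) (chi : nat -> R) :
  (0 < T)%nat -> (0 < J)%nat -> (0 < G)%nat -> 0 <= A ->
  (forall n v, 0 <= F n v) ->
  (forall n, rsum G (F n) = A) ->
  (forall v, 0 <= chi v <= 1) ->
  (forall j j', (j < J)%nat -> (j' < J)%nat ->
     rsum T (fun n => rsum G (fun v => F (n + j)%nat v * F (n + j')%nat v))
     <= INR T * A ^ 2 / INR G + Rem j j') ->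
  Rabs (rsum T (fun n => rsum G (fun v => chi v * F n v)) - INR T * A / INR G * rsum G chi)
  <= A * INR J + / INR J * sqrt (INR T * INR G * rsum J (fun j => rsum J (Rem j))).
Proof.
  intros HT HJ HG HA HF0 HF Hchi Hcor.
  assert (HT' : 0 < INR T) by (apply lt_0_INR; lia).
  assert (HJ' : 0 < INR J) by (apply lt_0_INR; lia).
  assert (HG' : 0 < INR G) by (apply lt_0_INR; lia).
  set (cc := fun n v => rsum J (fun j => F (n + j)%nat v)).
  set (mu := INR J * A / INR G).
  set (SR := rsum J (fun j => rsum J (Rem j))).
  set (B := fun n => rsum G (fun v => chi v * F n v)).
  assert (Hcc : forall n, rsum G (cc n) = INR J * A).
  { intros n. unfold cc. rewrite rsum_swap.
    rewrite (rsum_ext _ _ (fun _ => A)) by (intros; apply HF). apply rsum_const. }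
  (* Completing the square uses the exact total of [cc n]; the main terms then cancel and only the
     excess [Rem] survives. *)
  assert (Hvar : rsum T (fun n => rsum G (fun v => (cc n v - mu) ^ 2)) <= SR).
  { rewrite (rsum_ext _ _ (fun n => rsum G (fun v => cc n v ^ 2) - INR J ^ 2 * A ^ 2 / INR G)).
    2:{ intros n _.
        rewrite (rsum_ext _ _ (fun v => cc n v ^ 2 - (2 * mu) * cc n v + mu ^ 2)) by (intros; ring).
        rewrite rsum_plus, rsum_minus, rsum_scal, rsum_const, Hcc. unfold mu. field. lra. }
    rewrite rsum_minus, rsum_const.
    rewrite (rsum_ext _ _ (fun n => rsum J (fun j => rsum J (fun j' =>
       rsum G (fun v => F (n + j)%nat v * F (n + j')%nat v))))).
    2:{ intros n _. unfold cc.
        rewrite (rsum_ext _ _ (fun v => rsum J (fun j => rsum J (fun j' =>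
          F (n + j)%nat v * F (n + j')%nat v)))) by (intros v _; rewrite <- rsum_mul; ring).
        rewrite rsum_swap. apply rsum_ext; intros j _. rewrite rsum_swap. reflexivity. }
    rewrite rsum_swap.
    apply Rle_trans with (rsum J (fun j => rsum J (fun j' =>
       INR T * A ^ 2 / INR G + Rem j j')) - INR T * (INR J ^ 2 * A ^ 2 / INR G)).
    - apply Rplus_le_compat_r. apply rsum_le; intros j Hj. rewrite rsum_swap.
      apply rsum_le; intros j' Hj'. apply Hcor; assumption.
    - unfold SR. rewrite (rsum_ext _ _ (fun j => INR J * (INR T * A ^ 2 / INR G) + rsum J (Rem j))).
      2:{ intros; rewrite rsum_plus, rsum_const; reflexivity. }
      rewrite rsum_plus, rsum_const. apply Req_le. field. lra. }
  set (D := rsum T (fun n => rsum G (fun v => chi v * (cc n v - mu)))).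
  assert (HSR : 0 <= SR).
  { eapply Rle_trans; [|exact Hvar]. apply rsum_nonneg; intros; apply rsum_nonneg; intros; apply pow2_ge_0. }
  assert (HD : Rabs D <= sqrt (INR T * INR G * SR)).
  { rewrite <- sqrt_Rsqr_abs. apply sqrt_le_1_alt. unfold Rsqr.
    replace (D * D) with (D ^ 2) by ring. unfold D.
    eapply Rle_trans; [apply rsum_sqr_le|]. rewrite Rmult_assoc.
    apply Rmult_le_compat_l; [lra|].
    apply Rle_trans with (rsum T (fun n => INR G * rsum G (fun v => (cc n v - mu) ^ 2))).
    2:{ rewrite rsum_scal. apply Rmult_le_compat_l; lra. }
    apply rsum_le; intros n _. eapply Rle_trans; [apply rsum_sqr_le|].
    apply Rmult_le_compat_l; [lra|]. apply rsum_le; intros v _.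
    specialize (Hchi v). assert (chi v ^ 2 <= 1) by nra.
    rewrite Rpow_mult_distr. assert (0 <= (cc n v - mu) ^ 2) by apply pow2_ge_0. nra. }
  assert (HB : forall n, 0 <= B n <= A).
  { intros n. split.
    - apply rsum_nonneg; intros v _. apply Rmult_le_pos; [apply Hchi|apply HF0].
    - rewrite <- (HF n). apply rsum_le; intros v _.
      specialize (Hchi v). specialize (HF0 n v). nra. }
  assert (HDB : D = rsum J (fun j => rsum T (fun n => B (n + j)%nat)) - INR T * mu * rsum G chi).
  { unfold D, B, cc.
    rewrite (rsum_ext _ _ (fun n => rsum J (fun j => rsum G (fun v => chi v * F (n + j)%nat v))
       - mu * rsum G chi)).
    - rewrite rsum_minus, rsum_const, rsum_swap. ring.
    - intros n _. rewrite rsum_swap, <- rsum_scal, <- rsum_minus. apply rsum_ext; intros v _.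
      rewrite rsum_scal. ring. }
  (* Moving the range by [j] exchanges at most [j] terms at each end, each between 0 and [A]; this
     is the origin of the term [A * INR J]. *)
  assert (Hsh : forall j, (j < J)%nat ->
     Rabs (rsum T (fun n => B (n + j)%nat) - rsum T B) <= A * INR J).
  { intros j Hj.
    assert (E1 := rsum_app j T B). assert (E2 := rsum_app T j B).
    rewrite Nat.add_comm in E1. rewrite E1 in E2.
    rewrite (rsum_ext T _ (fun i => B (j + i)%nat)) by (intros; f_equal; lia).
    assert (L1 : 0 <= rsum j B) by (apply rsum_nonneg; intros; apply HB).
    assert (L2 : rsum j B <= INR j * A) by (apply rsum_le_const; intros; apply HB).
    assert (L3 : 0 <= rsum j (fun i => B (T + i)%nat)) by (apply rsum_nonneg; intros; apply HB).
    assert (L4 : rsum j (fun i => B (T + i)%nat) <= INR j * A) by (apply rsum_le_const; intros; apply HB).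
    assert (INR j <= INR J) by (apply le_INR; lia).
    assert (INR j * A <= A * INR J) by nra.
    apply Rabs_le. lra. }
  assert (Hall : Rabs (rsum J (fun j => rsum T (fun n => B (n + j)%nat)) - INR J * rsum T B)
     <= INR J * (A * INR J)).
  { rewrite <- rsum_const, <- rsum_minus. eapply Rle_trans; [apply rsum_abs|].
    apply rsum_le_const. exact Hsh. }
  replace (rsum T B - INR T * A / INR G * rsum G chi) with
    (/ INR J * (D - (rsum J (fun j => rsum T (fun n => B (n + j)%nat)) - INR J * rsum T B))).
  2:{ rewrite HDB. unfold mu. field. lra. }
  rewrite Rabs_mult, (Rabs_pos_eq (/ INR J)) by (left; apply Rinv_0_lt_compat; lra).
  apply Rle_trans with (/ INR J * (sqrt (INR T * INR G * SR) + INR J * (A * INR J))).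
  - apply Rmult_le_compat_l; [left; apply Rinv_0_lt_compat; lra|].
    eapply Rle_trans; [apply Rabs_triang|]. rewrite Rabs_Ropp. lra.
  - apply Req_le. field. lra.
Qed.

(** * Integer parts of slowly growing sequences *)

Definition nfloor (r : R) : nat := Z.to_nat (Rfloor r).

Lemma nfloor_spec (r : R) : 0 <= r -> INR (nfloor r) <= r < INR (nfloor r) + 1.
Proof.
  intros Hr. unfold nfloor, Rfloor. destruct (archimed r) as [H1 H2].
  assert (H : (0 < up r)%Z) by (apply lt_IZR; simpl; lra).
  rewrite INR_IZR_INZ, Z2Nat.id, minus_IZR by lia. lra.
Qed.

Lemma nfloor_unique (r : R) (n : nat) : INR n <= r < INR n + 1 -> nfloor r = n.
Proof.
  intros H. pose proof (pos_INR n).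
  destruct (nfloor_spec r ltac:(lra)) as [H1 H2].
  assert (n < S (nfloor r))%nat by (apply INR_lt; rewrite S_INR; lra).
  assert (nfloor r < S n)%nat by (apply INR_lt; rewrite S_INR; lra). lia.
Qed.

Lemma nfloor_le (r s : R) : 0 <= r <= s -> (nfloor r <= nfloor s)%nat.
Proof.
  intros H. destruct (nfloor_spec r ltac:(lra)), (nfloor_spec s ltac:(lra)).
  assert (nfloor r < S (nfloor s))%nat by (apply INR_lt; rewrite S_INR; lra). lia.
Qed.

Lemma nfloor_ge_nat (r : R) (n : nat) : INR n <= r -> (n <= nfloor r)%nat.
Proof.
  intros H. pose proof (pos_INR n). destruct (nfloor_spec r ltac:(lra)).
  assert (n < S (nfloor r))%nat by (apply INR_lt; rewrite S_INR; lra). lia.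
Qed.

Lemma nfloor_add (x y : R) : 0 <= x -> 0 <= y ->
  nfloor (x + y) = (nfloor x + nfloor y)%nat \/
  nfloor (x + y) = (nfloor x + (nfloor y + 1))%nat.
Proof.
  intros Hx Hy. destruct (nfloor_spec x Hx), (nfloor_spec y Hy).
  destruct (Rlt_dec (x + y) (INR (nfloor x) + INR (nfloor y) + 1)); [left|right];
    apply nfloor_unique; rewrite !plus_INR; simpl; lra.
Qed.

(** Reading [x] at resolution 1/X loses nothing of its integer part, so the single integer
    [nfloor (INR X * x)] carries both the integer part and a discretised fractional part. *)
Lemma nfloor_div (x : R) (X : nat) : 0 <= x -> (0 < X)%nat ->
  nfloor x = (nfloor (INR X * x) / X)%nat.
Proof.
  intros Hx HX. assert (HX' : 0 < INR X) by (apply lt_0_INR; lia).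
  destruct (nfloor_spec (INR X * x)) as [H1 H2]; [nra|].
  set (z := nfloor (INR X * x)) in *.
  pose proof (Nat.div_mod_eq z X) as E. pose proof (Nat.mod_upper_bound z X ltac:(lia)) as M.
  apply nfloor_unique.
  assert (L1 : (X * (z / X) <= z)%nat) by lia.
  assert (L2 : (z + 1 <= X * (z / X) + X)%nat) by lia.
  apply le_INR in L1, L2. rewrite !plus_INR, !mult_INR in *. simpl (INR 1) in L2.
  split; [apply Rmult_le_reg_l with (INR X); lra|].
  apply Rmult_lt_reg_l with (INR X); lra.
Qed.

Definition slopes (L : nat) (lam Lam : R) (u : nat -> R) : Prop :=
  forall n m, (n < m)%nat -> (m < L)%nat ->
    lam * INR (m - n) <= u m - u n <= Lam * INR (m - n).

(** Consecutive points of the fiber are at least [lam] apart: the last one counted lies at or above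
    [t + (count - 1) * lam], yet below [t + 1]. *)
Lemma slopes_floor_fiber (L t : nat) (lam Lam : R) (u : nat -> R) :
  0 < lam -> (forall n, 0 <= u n) -> slopes L lam Lam u ->
  rsum L (fun n => indic (Nat.eqb (nfloor (u n)) t)) <= / lam + 1.
Proof.
  intros Hlam Hu0 Hu.
  set (cnt := fun k => rsum k (fun n => indic (Nat.eqb (nfloor (u n)) t))).
  assert (H : forall k, (k <= L)%nat -> cnt k = 0 \/
     exists n, (n < k)%nat /\ nfloor (u n) = t /\ INR t + (cnt k - 1) * lam <= u n).
  { induction k as [|k IH]; intros Hk; [left; reflexivity|].
    unfold cnt in *; simpl in *. destruct (Nat.eqb_spec (nfloor (u k)) t) as [E|E]; simpl.
    - right. destruct (IH ltac:(lia)) as [H0|[n [Hn [E' H0]]]].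
      + exists k. repeat split; [lia|exact E|]. rewrite H0.
        destruct (nfloor_spec (u k) (Hu0 k)). rewrite E in *. lra.
      + exists k. repeat split; [lia|exact E|].
        destruct (Hu n k ltac:(lia) ltac:(lia)) as [H1 _].
        assert (1 <= INR (k - n)) by (apply (le_INR 1); lia). nra.
    - destruct (IH ltac:(lia)) as [H0|[n [Hn [E' H0]]]]; [left; lra|].
      right. exists n. repeat split; [lia|exact E'|lra]. }
  pose proof (Rinv_0_lt_compat lam Hlam) as Hil.
  destruct (H L (le_n L)) as [H0|[n [_ [E H0]]]]; unfold cnt in *; [lra|].
  destruct (nfloor_spec (u n) (Hu0 n)) as [_ H1]. rewrite E in H1.
  set (s := rsum L _) in *. apply Rplus_le_reg_r with (-1).
  apply Rmult_le_reg_r with lam; [lra|].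
  replace ((/ lam + 1 + -1) * lam) with 1 by (field; lra). lra.
Qed.

(** The bound is the product of three counts: aligned blocks of length [G] met by the values, visits
    to one integer, and mass of [E] in a block. It is applied to the kernel [overlap] and to the
    contraction factor [osc]. *)
Lemma slopes_floor_sum (L G : nat) (lam Lam S : R) (u E : nat -> R) :
  (0 < G)%nat -> 0 < lam -> 0 <= Lam -> (forall n, 0 <= u n) -> slopes L lam Lam u ->
  (forall x, 0 <= E x) ->
  (forall y, rsum G (fun r => E (y * G + r)%nat) <= S) ->
  rsum L (fun n => E (nfloor (u n))) <= (Lam * INR L / INR G + 2) * (/ lam + 1) * S.
Proof.
  intros HG Hlam HLam Hu0 Hu HE HS.
  assert (HG' : 0 < INR G) by (apply lt_0_INR; lia).
  assert (HS0 : 0 <= S).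
  { eapply Rle_trans; [|apply (HS 0%nat)]. apply rsum_nonneg; intros; apply HE. }
  pose proof (Rinv_0_lt_compat lam Hlam) as Hil.
  assert (Hq : 0 <= Lam * INR L / INR G).
  { apply Rmult_le_pos; [apply Rmult_le_pos; [lra|apply pos_INR]|].
    left; apply Rinv_0_lt_compat; lra. }
  (* The 2 covers the incomplete blocks at both ends. *)
  set (M := (nfloor (Lam * INR L / INR G) + 2)%nat).
  destruct (nfloor_spec _ Hq) as [M1 M2].
  set (y0 := (nfloor (u 0%nat) / G)%nat).
  assert (Hblock : forall n, (n < L)%nat ->
     (y0 <= nfloor (u n) / G < y0 + M)%nat).
  { intros n Hn.
    assert (H0 : 0 <= u n - u 0%nat <= Lam * INR L).
    { destruct n as [|n].
      - pose proof (pos_INR L). split; nra.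
      - destruct (Hu 0%nat (Datatypes.S n) ltac:(lia) Hn) as [H1 H2].
        rewrite Nat.sub_0_r in *.
        assert (INR (Datatypes.S n) <= INR L) by (apply le_INR; lia).
        pose proof (pos_INR (Datatypes.S n)). split; nra. }
    split.
    - apply Nat.Div0.div_le_mono. apply nfloor_le. specialize (Hu0 0%nat); lra.
    - set (z := nfloor (u n)). set (z0 := nfloor (u 0%nat)) in *.
      destruct (nfloor_spec (u n) (Hu0 n)) as [Z1 Z2]. destruct (nfloor_spec (u 0%nat) (Hu0 0%nat)) as [Z3 Z4].
      fold z in Z1, Z2; fold z0 in Z3, Z4.
      apply Nat.Div0.div_lt_upper_bound. apply INR_lt. rewrite mult_INR, plus_INR.
      unfold M. rewrite plus_INR. simpl (INR 2).
      assert (Hz0 : (z0 + 1 <= G * y0 + G)%nat).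
      { unfold y0. pose proof (Nat.div_mod_eq z0 G).
        pose proof (Nat.mod_upper_bound z0 G ltac:(lia)). lia. }
      apply le_INR in Hz0. rewrite !plus_INR, mult_INR in Hz0. simpl (INR 1) in Hz0.
      assert (Hr : Lam * INR L < INR G * (INR (nfloor (Lam * INR L / INR G)) + 1)).
      { replace (Lam * INR L) with (INR G * (Lam * INR L / INR G)) at 1 by (field; lra).
        apply Rmult_lt_compat_l; lra. }
      nra. }
  apply Rle_trans with (rsum L (fun n => rsum M (fun y => rsum G (fun r =>
     indic (Nat.eqb (nfloor (u n)) ((y0 + y) * G + r)) * E ((y0 + y) * G + r)%nat)))).
  { apply rsum_le; intros n Hn. specialize (Hblock n Hn).
    rewrite (rsum_ext M _ (fun y => rsum G (fun r => indic (Nat.eqb (nfloor (u n) - y0 * G) (y * G + r)) *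
        E (y0 * G + (y * G + r))%nat))).
    - rewrite <- (rsum_prod M G (fun i => indic (Nat.eqb (nfloor (u n) - y0 * G) i) * E (y0 * G + i)%nat)).
      rewrite rsum_single.
      + apply Req_le. f_equal.
        pose proof (Nat.div_mod_eq (nfloor (u n)) G). nia.
      + pose proof (Nat.div_mod_eq (nfloor (u n)) G).
        pose proof (Nat.mod_upper_bound (nfloor (u n)) G ltac:(lia)). nia.
    - intros y _. apply rsum_ext; intros r _. f_equal; [|f_equal; lia].
      f_equal. pose proof (Nat.div_mod_eq (nfloor (u n)) G).
      destruct (Nat.eqb_spec (nfloor (u n)) ((y0 + y) * G + r)),
        (Nat.eqb_spec (nfloor (u n) - y0 * G) (y * G + r)); try reflexivity; nia. }
  rewrite rsum_swap.
  apply Rle_trans with (rsum M (fun y => (/ lam + 1) * S)).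
  - apply rsum_le; intros y _. rewrite rsum_swap.
    apply Rle_trans with (rsum G (fun r => (/ lam + 1) * E ((y0 + y) * G + r)%nat)).
    + apply rsum_le; intros r _.
      rewrite (rsum_ext _ _ (fun n => E ((y0 + y) * G + r)%nat *
        indic (Nat.eqb (nfloor (u n)) ((y0 + y) * G + r)))) by (intros; ring).
      rewrite rsum_scal, Rmult_comm. apply Rmult_le_compat_r; [apply HE|].
      apply slopes_floor_fiber with Lam; assumption.
    + rewrite rsum_scal. apply Rmult_le_compat_l; [lra|]. apply HS.
  - rewrite rsum_const, Rmult_assoc. apply Rmult_le_compat_r; [nra|].
    unfold M; rewrite plus_INR; simpl (INR 2); lra.
Qed.

(** * Equidistribution modulo an integer *)

Lemma mod_add_cancel_l (G z a b : nat) :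
  ((z + a) mod G = (z + b) mod G -> a mod G = b mod G)%nat.
Proof.
  intros H. destruct (Nat.eq_dec G 0) as [->|HG]; [simpl in *; lia|].
  assert (Hz : exists w, ((w + z) mod G = 0)%nat).
  { exists (z * G - z)%nat. replace (z * G - z + z)%nat with (z * G)%nat by nia.
    apply Nat.Div0.mod_mul. }
  destruct Hz as [w Hw].
  assert (E : forall x, ((w + (z + x)) mod G = x mod G)%nat).
  { intros x. rewrite Nat.add_assoc, <- Nat.Div0.add_mod_idemp_l, Hw. reflexivity. }
  rewrite <- (E a), <- (E b), <- Nat.Div0.add_mod_idemp_r, H, Nat.Div0.add_mod_idemp_r.
  reflexivity.
Qed.

(** The point mass at [z] modulo [G], smeared over [P] consecutive residues. Correlations of smeared
    masses depend on the distance of the centres through a kernel of width about [P], which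
    tolerates unit errors of integer parts. *)
Definition shifts (P G z v : nat) : R :=
  rsum P (fun b => indic (Nat.eqb ((z + b) mod G) v)).

Lemma shifts_weighted_sum (P G z : nat) (chi : nat -> R) : (0 < G)%nat ->
  rsum G (fun v => chi v * shifts P G z v) = rsum P (fun b => chi ((z + b) mod G)).
Proof.
  intros HG. unfold shifts.
  rewrite (rsum_ext _ _ (fun v => rsum P (fun b => indic (Nat.eqb ((z + b) mod G) v) * chi v))).
  2:{ intros v _. rewrite <- rsum_scal. apply rsum_ext; intros; ring. }
  rewrite rsum_swap. apply rsum_ext; intros b _. apply rsum_single.
  apply Nat.mod_upper_bound; lia.
Qed.

Lemma shifts_sum (P G z : nat) : (0 < G)%nat -> rsum G (shifts P G z) = INR P.
Proof.
  intros HG. rewrite (rsum_ext _ _ (fun v => 1 * shifts P G z v)) by (intros; ring).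
  rewrite (shifts_weighted_sum P G z (fun _ => 1) HG), rsum_const. ring.
Qed.

(* The extra value [b' = P] absorbs the possible carry in floor(x + y). *)
Definition overlap (P G u : nat) : R :=
  rsum P (fun b => rsum (P + 1) (fun b' => indic (Nat.eqb ((b' + u) mod G) b))).

Lemma shifts_correlation (P G z w : nat) : (0 < G)%nat ->
  rsum G (fun v => shifts P G z v * shifts P G w v) =
  rsum P (fun b => rsum P (fun b' => indic (Nat.eqb ((w + b') mod G) ((z + b) mod G)))).
Proof.
  intros HG. rewrite (rsum_ext _ _ (fun v => shifts P G w v * shifts P G z v)) by (intros; ring).
  rewrite shifts_weighted_sum by assumption. reflexivity.
Qed.

Lemma shifts_correlation_trivial (P G z w : nat) : (0 < P <= G)%nat ->
  rsum G (fun v => shifts P G z v * shifts P G w v) <= INR P.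
Proof.
  intros HG. rewrite shifts_correlation by lia. rewrite <- (Rmult_1_r (INR P)).
  apply rsum_le_const; intros b _.
  apply rsum_indic_unique; intros i j Hi Hj H1 H2.
  apply Nat.eqb_eq in H1, H2. rewrite <- H2 in H1.
  apply mod_add_cancel_l in H1. rewrite !Nat.mod_small in H1 by lia. exact H1.
Qed.

(** After [z] is cancelled, a carry [e] merely moves [b'] by one place, so both cases fit into the
    [P + 1] values of [b'] in [overlap]. *)
Lemma shifts_correlation_overlap (P G z w u : nat) : (0 < P <= G)%nat ->
  (w = z + u \/ w = z + (u + 1))%nat ->
  rsum G (fun v => shifts P G z v * shifts P G w v) <= overlap P G u.
Proof.
  intros HG Hw. rewrite shifts_correlation by lia. unfold overlap.
  apply rsum_le; intros b Hb.
  assert (Hx : exists e, (e <= 1)%nat /\ w = (z + (u + e))%nat) by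
    (destruct Hw as [->| ->]; [exists 0%nat|exists 1%nat]; lia).
  destruct Hx as [e [He ->]].
  apply Rle_trans with (rsum P (fun b' => indic (Nat.eqb ((e + b' + u) mod G) b))).
  { apply rsum_le; intros b' Hb'. apply indic_le. intros H. apply Nat.eqb_eq in H.
    rewrite <- Nat.add_assoc in H. apply mod_add_cancel_l in H.
    rewrite (Nat.mod_small b) in H by lia. apply Nat.eqb_eq. rewrite <- H. f_equal. lia. }
  destruct e as [|[|e]]; [| |lia].
  - rewrite rsum_app.
    rewrite <- (Rplus_0_r (rsum P _)) at 1. apply Rplus_le_compat; [apply Rle_refl|].
    apply rsum_nonneg; intros; apply indic_bounds.
  - rewrite (Nat.add_comm P 1), (rsum_app 1).
    rewrite <- (Rplus_0_l (rsum P _)) at 1. apply Rplus_le_compat; [|apply Rle_refl].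
    apply rsum_nonneg; intros; apply indic_bounds.
Qed.

Lemma overlap_nonneg (P G u : nat) : 0 <= overlap P G u.
Proof.
  apply rsum_nonneg; intros; apply rsum_nonneg; intros; apply indic_bounds.
Qed.

(** Each pair of [b] and [b'] is matched by at most one [r] of a complete residue system. The extra
    value of [b'] costs only a relative 1/P over the ideal total [P^2]. *)
Lemma overlap_block (P G y : nat) : (0 < G)%nat ->
  rsum G (fun r => overlap P G (y * G + r)) <= INR P * (INR P + 1).
Proof.
  intros HG. unfold overlap. rewrite rsum_swap. apply rsum_le_const; intros b _.
  rewrite rsum_swap. replace (INR P + 1) with (INR (P + 1) * 1) by (rewrite plus_INR; simpl; ring).
  apply rsum_le_const; intros b' _.
  rewrite (rsum_ext _ _ (fun r => indic (Nat.eqb ((r + (b' + y * G)) mod G) b))).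
  - apply rsum_indic_mod; assumption.
  - intros r _. replace (b' + (y * G + r))%nat with (r + (b' + y * G))%nat by lia. reflexivity.
Qed.

(** With [t = T / G], the product of the first two factors expands to
    [t * (A / a) + t * A + 2 / a + 2]. The four inequalities before the conclusion bound the first
    term by [t * (1 + 1 / P)] and each other term by [t / P]. *)
Lemma long_correlation_bound (P T G a A : R) :
  1 <= P -> 0 < T -> 0 < G -> 0 < a ->
  A * P <= a * (P + 1) -> A * P <= 1 -> 2 * G * P <= T * a -> 2 * G * P <= T ->
  (A * T / G + 2) * (/ a + 1) * (P * (P + 1)) <= T * P ^ 2 / G + 9 * P * T / G.
Proof.
  intros HP HT HG Ha H1 H2 H3 H4.
  set (t := T / G). assert (Et : T = t * G) by (unfold t; field; lra).
  assert (Ht : 0 < t) by (unfold t; apply Rdiv_lt_0_compat; lra).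
  assert (HiP : 0 < / P) by (apply Rinv_0_lt_compat; lra).
  assert (Hia : 0 < / a) by (apply Rinv_0_lt_compat; lra).
  assert (K1 : A * / a <= 1 + / P).
  { apply Rmult_le_reg_r with (a * P); [nra|]. field_simplify; lra. }
  assert (K2 : A <= / P).
  { apply Rmult_le_reg_r with P; [lra|]. field_simplify; lra. }
  assert (K3 : 2 * / a <= t * / P).
  { apply Rmult_le_reg_r with (a * P * G); [apply Rmult_lt_0_compat; nra|].
    unfold t. field_simplify; lra. }
  assert (K4 : 2 <= t * / P).
  { apply Rmult_le_reg_r with (P * G); [nra|]. unfold t. field_simplify; lra. }
  replace (A * T / G) with (A * t) by (unfold t; field; lra).
  replace (T * P ^ 2 / G) with (t * P ^ 2) by (unfold t; field; lra).
  replace (9 * P * T / G) with (t * (9 * P)) by (unfold t; field; lra).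
  apply Rle_trans with (t * (1 + 4 * / P) * (P * (P + 1))).
  - apply Rmult_le_compat_r; [nra|].
    replace ((A * t + 2) * (/ a + 1)) with (t * (A * / a) + t * A + 2 * / a + 2) by ring.
    assert (t * (A * / a) <= t * (1 + / P)) by (apply Rmult_le_compat_l; lra).
    assert (t * A <= t * / P) by (apply Rmult_le_compat_l; lra). lra.
  - rewrite Rmult_assoc, <- Rmult_plus_distr_l. apply Rmult_le_compat_l; [lra|].
    replace ((1 + 4 * / P) * (P * (P + 1))) with (P ^ 2 + 5 * P + 4) by (field; lra). lra.
Qed.

(** A discrete form of lam <= phi'' <= Lam, stated for mixed second differences so that each
    increment of [phi] inherits [slopes]. *)
Definition second_slopes (L : nat) (lam Lam : R) (phi : nat -> R) : Prop :=
  forall h n m, (0 < h)%nat -> (n < m)%nat -> (m + h <= L)%nat ->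
    lam * INR h * INR (m - n) <= (phi (m + h)%nat - phi m) - (phi (n + h)%nat - phi n)
    <= Lam * INR h * INR (m - n).

(* With z = floor(X phi), the correlation of z(n) and z(n+h) modulo G is governed
   by the slowly growing difference phi(n+h) - phi(n), which for h >= h0 winds
   around the circle many times. *)
Lemma equidistribution (P J Q X h0 : nat) (lam Lam : R) (phi chi : nat -> R) :
  (0 < P)%nat -> (0 < J)%nat -> (P <= Q * X)%nat -> 0 < lam ->
  (forall n, 0 <= phi n) -> (forall n h, phi n <= phi (n + h)%nat) ->
  second_slopes (2 * (P * J)) lam Lam phi ->
  INR X * Lam * INR J * INR P <= 1 ->
  Lam * INR P <= lam * (INR P + 1) ->
  2 * INR (Q * X) * INR P <= INR (P * J) * INR X * lam * INR h0 ->
  2 * INR (Q * X) * INR P <= INR (P * J) ->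
  (2 * h0 * (Q * X) <= J)%nat ->
  (forall v, 0 <= chi v <= 1) ->
  rsum (P * J) (fun i => rsum P (fun b => chi ((nfloor (INR X * phi i) + b) mod (Q * X))%nat))
  <= INR (P * J) * INR P * (rsum (Q * X) chi / INR (Q * X) + 5 / sqrt (INR P)).
Proof.
  intros HP HJ HPG Hlam Hphi0 Hmono Hsl C1 C2 C3 C4 C5 Hchi.
  set (T := (P * J)%nat) in *. set (G := (Q * X)%nat) in *.
  assert (HT : (0 < T)%nat) by (unfold T; nia).
  assert (HG : (0 < G)%nat) by lia.
  assert (HX : (0 < X)%nat) by (unfold G in HG; nia).
  assert (HP' : 1 <= INR P) by (apply (le_INR 1); lia).
  assert (HJ' : 1 <= INR J) by (apply (le_INR 1); lia).
  assert (HT' : 0 < INR T) by (apply lt_0_INR; lia).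
  assert (HG' : 0 < INR G) by (apply lt_0_INR; lia).
  assert (HX' : 1 <= INR X) by (apply (le_INR 1); lia).
  assert (Hh0 : (0 < h0)%nat).
  { destruct h0; [simpl in C3; nra|lia]. }
  assert (HLam : lam <= Lam).
  { destruct (Hsl 1%nat 0%nat 1%nat ltac:(lia) ltac:(lia)) as [A1 A2].
    - unfold T. assert (P * J >= 1)%nat by nia. lia.
    - simpl in A1, A2. lra. }
  set (z := fun i => nfloor (INR X * phi i)).
  set (F := fun n => shifts P G (z n)).
  (* The second term is the trivial bound for pairs at distance up to about [h0], a window of
     [2 * h0] values of [j'] written without subtraction. *)
  set (Rem := fun j j' => 9 * INR P * INR T / INR G +
     INR T * INR P * indic (Nat.leb (j + 1) (j' + h0) && Nat.ltb (j' + h0) (j + 1 + 2 * h0))).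
  assert (Hlong : forall j h, (h0 <= h)%nat -> (j + h < J)%nat ->
    rsum T (fun n => rsum G (fun v => F (n + j)%nat v * F (n + (j + h))%nat v))
     <= INR T * INR P ^ 2 / INR G + 9 * INR P * INR T / INR G).
  { intros j h Hh Hjh.
    set (u := fun i => INR X * (phi (i + j + h)%nat - phi (i + j)%nat)).
    assert (Hu : forall i, 0 <= u i).
    { intros i. apply Rmult_le_pos; [lra|]. specialize (Hmono (i + j)%nat h). lra. }
    assert (Hh' : INR h0 <= INR h) by (apply le_INR; lia).
    assert (HhJ : INR h <= INR J) by (apply le_INR; lia).
    assert (Hh1 : 1 <= INR h0) by (apply (le_INR 1); lia).
    apply Rle_trans with (rsum T (fun i => overlap P G (nfloor (u i)))).
    { apply rsum_le; intros i Hi. apply shifts_correlation_overlap; [lia|].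
      unfold z. replace (INR X * phi (i + (j + h))%nat) with (INR X * phi (i + j)%nat + u i).
      - apply nfloor_add; [|apply Hu]. apply Rmult_le_pos; [lra|apply Hphi0].
      - unfold u. replace (i + (j + h))%nat with (i + j + h)%nat by lia. ring. }
    eapply Rle_trans.
    { apply slopes_floor_sum with (G := G) (lam := INR X * lam * INR h) (Lam := INR X * Lam * INR h)
        (S := INR P * (INR P + 1)).
      - exact HG.
      - apply Rmult_lt_0_compat; nra.
      - apply Rmult_le_pos; nra.
      - exact Hu.
      - intros n m Hnm Hm. unfold u.
        destruct (Hsl h (n + j)%nat (m + j)%nat ltac:(lia) ltac:(lia)) as [A1 A2].
        { unfold T in *. assert (J <= P * J)%nat by nia. lia. }
        replace (m + j - (n + j))%nat with (m - n)%nat in * by lia. split; nra.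
      - intros; apply overlap_nonneg.
      - intros; apply overlap_block; exact HG. }
    apply long_correlation_bound; try lra.
    - apply Rmult_lt_0_compat; nra.
    - assert (0 < INR X * INR h) by nra. nra.
    - assert (INR X * Lam * INR h <= INR X * Lam * INR J) by (apply Rmult_le_compat_l; nra). nra.
    - assert (0 <= INR T * INR X * lam) by (apply Rmult_le_pos; nra). nra. }
  assert (Hshort : forall j j',
    rsum T (fun n => rsum G (fun v => F (n + j)%nat v * F (n + j')%nat v)) <= INR T * INR P).
  { intros j j'. apply rsum_le_const; intros i _. apply shifts_correlation_trivial. lia. }
  assert (Hmain0 : 0 <= INR T * INR P ^ 2 / INR G).
  { apply Rmult_le_pos; [nra|]. left; apply Rinv_0_lt_compat; lra. }
  assert (Hmain1 : 0 <= 9 * INR P * INR T / INR G).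
  { apply Rmult_le_pos; [nra|]. left; apply Rinv_0_lt_compat; lra. }
  assert (HSM := second_moment T J G (INR P) F Rem chi HT HJ HG ltac:(lra)).
  specialize (HSM ltac:(intros; apply rsum_nonneg; intros; apply indic_bounds)
    ltac:(intros; apply shifts_sum; exact HG) Hchi).
  assert (Hcor : forall j j', (j < J)%nat -> (j' < J)%nat ->
     rsum T (fun n => rsum G (fun v => F (n + j)%nat v * F (n + j')%nat v))
     <= INR T * INR P ^ 2 / INR G + Rem j j').
  { intros j j' Hj Hj'. unfold Rem.
    destruct (Nat.leb_spec (j + 1) (j' + h0)) as [B1|B1];
      [destruct (Nat.ltb_spec (j' + h0) (j + 1 + 2 * h0)) as [B2|B2]|]; simpl indic.
    - specialize (Hshort j j'). lra.
    - rewrite Rmult_0_r, Rplus_0_r. replace j' with (j + (j' - j))%nat by lia.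
      apply Hlong; lia.
    - rewrite Rmult_0_r, Rplus_0_r.
      rewrite (rsum_ext _ _ (fun n => rsum G (fun v => F (n + j')%nat v * F (n + j)%nat v))).
      + replace j with (j' + (j - j'))%nat by lia. apply Hlong; lia.
      + intros n _. apply rsum_ext; intros; ring. }
  (* By [C5] the near pairs contribute at most one more unit of J P T / G for each [j], which raises
     9 to 10. *)
  assert (HSR : rsum J (fun j => rsum J (Rem j)) <= 10 * INR J ^ 2 * INR P * INR T / INR G).
  { apply Rle_trans with (INR J * (INR J * (9 * INR P * INR T / INR G) + INR T * INR P * INR (2 * h0))).
    - apply rsum_le_const; intros j _. unfold Rem. rewrite rsum_plus, rsum_const, rsum_scal.
      apply Rplus_le_compat_l. apply Rmult_le_compat_l; [nra|]. apply rsum_indic_range.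
    - apply le_INR in C5. rewrite mult_INR in C5.
      apply Rmult_le_reg_r with (INR G); [lra|]. field_simplify; [|lra|lra].
      assert (0 <= INR J * INR T * INR P) by (apply Rmult_le_pos; nra). nra. }
  specialize (HSM Hcor).
  assert (HsP : 0 < sqrt (INR P)) by (apply sqrt_lt_R0; lra).
  assert (HsP2 : sqrt (INR P) * sqrt (INR P) = INR P) by (apply sqrt_sqrt; lra).
  (* The root of 10 is rounded up to 4; the edge term [INR P * INR J], equal to [INR T], later makes
     it 5. *)
  assert (Hroot : sqrt (INR T * INR G * rsum J (fun j => rsum J (Rem j)))
     <= 4 * INR T * INR J * sqrt (INR P)).
  { rewrite <- (sqrt_Rsqr (4 * INR T * INR J * sqrt (INR P))).
    2:{ apply Rmult_le_pos; [|lra]. apply Rmult_le_pos; lra. }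
    apply sqrt_le_1_alt. unfold Rsqr.
    replace (4 * INR T * INR J * sqrt (INR P) * (4 * INR T * INR J * sqrt (INR P))) with
      (16 * INR T ^ 2 * INR J ^ 2 * (sqrt (INR P) * sqrt (INR P))) by ring. rewrite HsP2.
    apply Rle_trans with (INR T * INR G * (10 * INR J ^ 2 * INR P * INR T / INR G)).
    - apply Rmult_le_compat_l; [nra|exact HSR].
    - field_simplify; [|lra].
      assert (0 <= INR T ^ 2 * INR J ^ 2 * INR P) by (apply Rmult_le_pos; nra). nra. }
  apply (Rle_trans _ _ _ (Rle_abs _)) in HSM.
  rewrite (rsum_ext T _ (fun i => rsum P (fun b => chi ((z i + b) mod G)%nat))) in HSM
    by (intros; apply shifts_weighted_sum; exact HG).
  assert (HJi : / INR J * sqrt (INR T * INR G * rsum J (fun j => rsum J (Rem j)))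
     <= 4 * INR T * sqrt (INR P)).
  { apply Rle_trans with (/ INR J * (4 * INR T * INR J * sqrt (INR P))).
    - apply Rmult_le_compat_l; [left; apply Rinv_0_lt_compat; lra|exact Hroot].
    - apply Req_le. field. lra. }
  assert (HPT : INR P * INR J = INR T) by (unfold T; rewrite mult_INR; ring).
  assert (HsP1 : 1 <= sqrt (INR P)) by (rewrite <- sqrt_1; apply sqrt_le_1_alt; lra).
  assert (Hfin : INR T * INR P * (rsum G chi / INR G + 5 / sqrt (INR P)) =
     INR T * INR P / INR G * rsum G chi + 5 * INR T * sqrt (INR P)).
  { rewrite <- HsP2 at 1 3. field. lra. }
  assert (INR T <= INR T * sqrt (INR P)) by (clear HSM; nra).
  rewrite Hfin. unfold z in HSM. lra.
Qed.

(** * Differences of digit sums *)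

Lemma digit_sum_aux_fuel (q f g n : nat) : (2 <= q)%nat -> (n <= f)%nat -> (n <= g)%nat ->
  digit_sum_aux f q n = digit_sum_aux g q n.
Proof.
  intros Hq. revert g n. induction f as [|f IH]; intros g n Hf Hg.
  - replace n with 0%nat by lia. destruct g; reflexivity.
  - destruct g as [|g].
    + replace n with 0%nat by lia. reflexivity.
    + simpl. destruct (Nat.eqb_spec n 0) as [|Hn]; [reflexivity|].
      assert (n / q < n)%nat by (apply Nat.div_lt; lia).
      rewrite (IH g) by lia. reflexivity.
Qed.

Lemma digit_sum_0 (q : nat) : digit_sum q 0 = 0%nat.
Proof. reflexivity. Qed.

Lemma digit_sum_step (q m d : nat) : (2 <= q)%nat -> (d < q)%nat ->
  digit_sum q (q * m + d) = (d + digit_sum q m)%nat.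
Proof.
  intros Hq Hd. destruct (Nat.eq_dec (q * m + d) 0) as [E|E].
  - rewrite E. assert (m = 0%nat) by nia. assert (d = 0%nat) by lia. subst. reflexivity.
  - unfold digit_sum at 1.
    rewrite (digit_sum_aux_fuel q _ (S (q * m + d))) by lia.
    cbn [digit_sum_aux]. destruct (Nat.eqb_spec (q * m + d) 0) as [|_]; [lia|].
    assert (Hm : ((q * m + d) mod q = d)%nat).
    { symmetry. apply Nat.mod_unique with m; [lia|lia]. }
    assert (Hdv : ((q * m + d) / q = m)%nat).
    { symmetry. apply Nat.div_unique with d; lia. }
    rewrite Hm, Hdv. f_equal. apply digit_sum_aux_fuel; nia.
Qed.

Lemma digit_sum_pow (q a m d : nat) : (2 <= q)%nat -> (d < q ^ a)%nat ->
  digit_sum q (m * q ^ a + d) = (digit_sum q m + digit_sum q d)%nat.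
Proof.
  intros Hq. revert d. induction a as [|a IH]; intros d Hd.
  - simpl in *. replace d with 0%nat by lia. rewrite Nat.mul_1_r, Nat.add_0_r, digit_sum_0. lia.
  - simpl in Hd. pose proof (Nat.div_mod_eq d q) as E.
    pose proof (Nat.mod_upper_bound d q ltac:(lia)) as Hr.
    assert (Hd1 : (d / q < q ^ a)%nat) by (apply Nat.Div0.div_lt_upper_bound; exact Hd).
    replace (m * q ^ S a + d)%nat with (q * (m * q ^ a + d / q) + d mod q)%nat by (simpl; nia).
    rewrite digit_sum_step, IH by assumption.
    rewrite E at 3. rewrite digit_sum_step by assumption. lia.
Qed.

Lemma digit_sum_lt (q d : nat) : (2 <= q)%nat -> (d < q)%nat -> digit_sum q d = d.
Proof.
  intros Hq Hd. rewrite <- (Nat.add_0_l d) at 1. rewrite <- (Nat.mul_0_r q).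
  rewrite digit_sum_step, digit_sum_0 by assumption. lia.
Qed.

Lemma digit_sum_pow_pred (q t : nat) : (2 <= q)%nat ->
  digit_sum q (q ^ t - 1) = (t * (q - 1))%nat.
Proof.
  intros Hq. induction t as [|t IH]; [reflexivity|].
  assert (1 <= q ^ t)%nat by (apply Nat.neq_0_lt_0, Nat.pow_nonzero; lia).
  replace (q ^ S t - 1)%nat with (q * (q ^ t - 1) + (q - 1))%nat by (simpl; nia).
  rewrite digit_sum_step, IH by lia. simpl. lia.
Qed.

Definition divides_b (x : Z) (M : nat) : bool := Z.eqb (x mod Z.of_nat M) 0.

Lemma divides_b_shift (x y : Z) (M : nat) (z : Z) : (0 < M)%nat ->
  (x - y = z * Z.of_nat M)%Z -> divides_b x M = divides_b y M.
Proof.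
  intros HM E. unfold divides_b. replace x with (y + z * Z.of_nat M)%Z by lia.
  rewrite Z_mod_plus_full. reflexivity.
Qed.

Lemma rsum_divides_b (x : Z) (M : nat) : (0 < M)%nat ->
  rsum M (fun l => indic (divides_b (x - Z.of_nat l) M)) = 1.
Proof.
  intros HM. pose proof (Z.mod_pos_bound x (Z.of_nat M) ltac:(lia)) as Hb.
  pose proof (Z.div_mod x (Z.of_nat M) ltac:(lia)) as Ex.
  rewrite (rsum_ext _ _ (fun l => indic (Nat.eqb (Z.to_nat (x mod Z.of_nat M)) l))).
  - apply rsum_indic_single. lia.
  - intros l Hl. f_equal.
    rewrite (divides_b_shift _ (x mod Z.of_nat M - Z.of_nat l) M (x / Z.of_nat M)) by lia.
    unfold divides_b. set (y := (x mod Z.of_nat M)%Z) in *.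
    destruct (Nat.eqb_spec (Z.to_nat y) l) as [E|E].
    + replace (y - Z.of_nat l)%Z with 0%Z by lia. reflexivity.
    + apply Z.eqb_neq. intros H. apply Z.mod_divide in H; [|lia].
      destruct H as [k Hk]. assert (k = 0)%Z by nia. lia.
Qed.

(** As a function of [l] the sum is invariant under translation by [M], and under translation by [a]
    because shifting [t] by one wraps around through the period. By Bezout these two translations
    generate all integers. *)
Lemma rsum_residues_invariant (p : Z -> R) (M a : nat) (l l' : Z) :
  (0 < M)%nat -> Nat.gcd M a = 1%nat ->
  (forall x z, p (x + z * Z.of_nat M)%Z = p x) ->
  rsum M (fun t => p (l + Z.of_nat t * Z.of_nat a)%Z) =
  rsum M (fun t => p (l' + Z.of_nat t * Z.of_nat a)%Z).
Proof.
  intros HM Hg Hp.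
  set (f := fun l => rsum M (fun t => p (l + Z.of_nat t * Z.of_nat a)%Z)).
  change (f l = f l').
  assert (H1 : forall x, f (x + Z.of_nat a)%Z = f x).
  { intros x. unfold f. set (g := fun t => p (x + Z.of_nat t * Z.of_nat a)%Z).
    rewrite (rsum_ext _ _ (fun t => g (1 + t)%nat)) by
      (intros; unfold g; f_equal; rewrite Nat2Z.inj_add; change (Z.of_nat 1) with 1%Z; ring).
    pose proof (rsum_app 1 M g) as E1. pose proof (rsum_app M 1 g) as E2.
    rewrite Nat.add_comm in E1. rewrite E1 in E2. simpl in E2.
    assert (E3 : g (M + 0)%nat = g 0%nat).
    { unfold g. rewrite <- (Hp (x + Z.of_nat 0 * Z.of_nat a)%Z (Z.of_nat a)). f_equal. rewrite Nat.add_0_r. change (Z.of_nat 0) with 0%Z. ring. }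
    simpl. lra. }
  assert (H2 : forall k x, f (x + Z.of_nat k * Z.of_nat a)%Z = f x).
  { induction k as [|k IH]; intros x; [f_equal; lia|].
    rewrite <- (IH x), <- (H1 (x + Z.of_nat k * Z.of_nat a)%Z). f_equal. rewrite Nat2Z.inj_succ. ring. }
  assert (H3 : forall x z, f (x + z * Z.of_nat M)%Z = f x).
  { intros x z. apply rsum_ext; intros t _. rewrite <- (Hp (x + Z.of_nat t * Z.of_nat a)%Z z). f_equal. ring. }
  assert (Hb : exists u v, (u * Z.of_nat M + v * Z.of_nat a = 1)%Z).
  { pose proof (Nat.gcd_bezout M a) as Hbz. rewrite Hg in Hbz. destruct Hbz as [[u [v E]]|[u [v E]]].
    - exists (Z.of_nat u), (- Z.of_nat v)%Z. lia.
    - exists (- Z.of_nat v)%Z, (Z.of_nat u). lia. }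
  destruct Hb as [u [v E]].
  set (w := ((l' - l) * v)%Z).
  pose proof (Z.mod_pos_bound w (Z.of_nat M) ltac:(lia)).
  pose proof (Z.div_mod w (Z.of_nat M) ltac:(lia)) as Ew.
  rewrite <- (H2 (Z.to_nat (w mod Z.of_nat M)) l).
  rewrite <- (H3 _ ((l' - l) * u + w / Z.of_nat M * Z.of_nat a)%Z).
  f_equal. rewrite Z2Nat.id by lia.
  replace (w mod Z.of_nat M)%Z with (w - Z.of_nat M * (w / Z.of_nat M))%Z by lia.
  replace l' with (l + (l' - l) * (u * Z.of_nat M + v * Z.of_nat a))%Z at 2 by (rewrite E; lia).
  unfold w. ring.
Qed.

Lemma rsum_injection_le (n M : nat) (D : nat -> nat) (y : nat -> R) :
  (forall t, (t < M)%nat -> (D t < n)%nat) ->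
  (forall s t, (s < M)%nat -> (t < M)%nat -> D s = D t -> s = t) ->
  (forall d, (d < n)%nat -> 0 <= y d) ->
  rsum M (fun t => y (D t)) <= rsum n y.
Proof.
  intros HD Hinj Hy.
  rewrite (rsum_ext M _ (fun t => rsum n (fun d => indic (Nat.eqb (D t) d) * y d)))
    by (intros; rewrite rsum_single by auto; reflexivity).
  rewrite rsum_swap. apply rsum_le; intros d Hd.
  rewrite (rsum_ext _ _ (fun t => y d * indic (Nat.eqb (D t) d))) by (intros; ring).
  rewrite rsum_scal. rewrite <- (Rmult_1_r (y d)) at 2.
  apply Rmult_le_compat_l; [auto|]. apply rsum_indic_unique; intros s t Hs Ht E1 E2.
  apply Nat.eqb_eq in E1, E2. apply Hinj; congruence || assumption.
Qed.

(** * Distribution of s(m+r) - s(m) modulo M *)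

Definition diff_count (q M n r : nat) (l : Z) : R :=
  rsum n (fun m => indic (divides_b (Z.of_nat (digit_sum q (m + r)) - Z.of_nat (digit_sum q m) - l) M)).

(** Fixing the [B] low digits [d] of the argument decides the carry passed on to [r]; the change of
    the low digit sum is moved into the residue. *)
Lemma diff_count_rec (q M B n r e : nat) (l : Z) : (2 <= q)%nat ->
  diff_count q M (n * q ^ B) (r * q ^ B + e) l =
  rsum (q ^ B) (fun d => diff_count q M n (r + (d + e) / q ^ B)
     (l + Z.of_nat (digit_sum q d) - Z.of_nat (digit_sum q ((d + e) mod q ^ B)))).
Proof.
  intros Hq. unfold diff_count. rewrite rsum_prod, rsum_swap.
  apply rsum_ext; intros d Hd. apply rsum_ext; intros m _.
  set (W := (q ^ B)%nat) in *.
  assert (HW : W <> 0%nat) by (apply Nat.pow_nonzero; lia).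
  pose proof (Nat.div_mod_eq (d + e) W) as E.
  pose proof (Nat.mod_upper_bound (d + e) W HW) as Hlt.
  replace (m * W + d + (r * W + e))%nat with ((m + (r + (d + e) / W)) * W + (d + e) mod W)%nat by nia.
  unfold W in *. rewrite !digit_sum_pow by assumption.
  do 2 f_equal. lia.
Qed.

Lemma diff_count_periodic (q M n r : nat) (l z : Z) : (0 < M)%nat ->
  diff_count q M n r (l + z * Z.of_nat M) = diff_count q M n r l.
Proof.
  intros HM. apply rsum_ext; intros m _. f_equal. apply divides_b_shift with (- z)%Z; lia.
Qed.

Lemma diff_count_bounds (q M n r : nat) (l : Z) : 0 <= diff_count q M n r l <= INR n.
Proof.
  split; [apply rsum_nonneg; intros; apply indic_bounds|].
  rewrite <- (Rmult_1_r (INR n)). apply rsum_le_const; intros; apply indic_bounds.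
Qed.

Lemma diff_count_total (q M n r : nat) : (0 < M)%nat ->
  rsum M (fun l => diff_count q M n r (Z.of_nat l)) = INR n.
Proof.
  intros HM. unfold diff_count. rewrite rsum_swap.
  rewrite (rsum_ext _ _ (fun _ => 1)) by (intros; apply rsum_divides_b; exact HM).
  rewrite rsum_const; ring.
Qed.

Definition block (q M : nat) : nat := (q ^ (M + 2))%nat.

(* Whenever a block of M+2 digits of r equals q, adding it to the blocks
   q^(t+1) - q with t < M changes their digit sums by 1 - t(q-1), that is by
   every residue modulo M once, without carry: this fraction of the blocks
   contributes a uniformly distributed difference. *)
Fixpoint osc (q M j r : nat) : R :=
  match j with
  | O => 1
  | S j' => osc q M j' (r / block q M) *
      (if Nat.eqb (r mod block q M) q then 1 - INR M / INR (block q M) else 1)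
  end.

Lemma block_bounds (q M : nat) : (2 <= q)%nat -> (M < block q M)%nat /\ (q < block q M)%nat.
Proof.
  intros Hq. unfold block. pose proof (Nat.pow_gt_lin_r q (M + 2) ltac:(lia)).
  pose proof (Nat.pow_lt_mono_r q 1 (M + 2) ltac:(lia) ltac:(lia)). simpl in *. lia.
Qed.

Lemma osc_bounds (q M j r : nat) : (2 <= q)%nat -> 0 <= osc q M j r <= 1.
Proof.
  intros Hq. revert r. induction j as [|j IH]; intros r; simpl; [lra|].
  specialize (IH (r / block q M)%nat). destruct (block_bounds q M Hq) as [HM _].
  apply lt_INR in HM. pose proof (pos_INR M).
  assert (0 <= INR M / INR (block q M) <= 1).
  { split.
    - apply Rmult_le_pos; [lra|left; apply Rinv_0_lt_compat; lra].
    - apply Rmult_le_reg_r with (INR (block q M)); [lra|].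
      unfold Rdiv. rewrite Rmult_assoc, Rinv_l by lra. lra. }
  destruct (Nat.eqb _ _); nra.
Qed.

(** On an aligned range the [j] digit blocks vary independently. Only the residue [q] loses M/W in a
    factor, so each block contributes [W - M / W] with [W = block q M]. *)
Lemma osc_block_sum (q M j y : nat) : (2 <= q)%nat ->
  rsum (block q M ^ j) (fun r => osc q M j (y * block q M ^ j + r)) =
  (INR (block q M) - INR M / INR (block q M)) ^ j.
Proof.
  intros Hq. destruct (block_bounds q M Hq) as [_ HW].
  set (W := block q M) in *.
  assert (HW' : 0 < INR W) by (apply lt_0_INR; lia).
  induction j as [|j IH]; [simpl; ring|].
  replace (W ^ S j)%nat with (W ^ j * W)%nat by (simpl; lia).
  rewrite rsum_prod.
  rewrite (rsum_ext _ _ (fun i => (INR W - INR M / INR W) * osc q M j (y * W ^ j + i))).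
  - rewrite rsum_scal, IH. reflexivity.
  - intros i _.
    rewrite (rsum_ext _ _ (fun e => osc q M j (y * W ^ j + i) * (1 - indic (Nat.eqb q e) * (INR M / INR W)))).
    + rewrite rsum_scal, rsum_minus, rsum_const.
      rewrite (rsum_single W q (fun _ => INR M / INR W)) by assumption. ring.
    + intros e He. cbn [osc]. fold W.
      replace (y * (W ^ j * W) + (i * W + e))%nat with ((y * W ^ j + i) * W + e)%nat by lia.
      rewrite Nat.div_add_l, Nat.div_small, Nat.add_0_r by lia.
      rewrite <- (Nat.mod_unique ((y * W ^ j + i) * W + e) W (y * W ^ j + i) e) by lia.
      rewrite (Nat.eqb_sym e q). destruct (Nat.eqb q e); simpl; ring.
Qed.

(** The block value is [q] rather than 1 because [q] and all [D t] end in the digit 0: the incoming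
    carry [e] falls on a free digit, and [D t + (q + e)] is [q^(t+1) + e] with digit sum [1 + e]
    even for [q = 2]. Over the [M] values of [t] the contributions to [l] and [l'] have equal sums,
    and the other blocks cost at most [Y] each. *)
Lemma good_block (q M n r e : nat) (l l' : Z) (Y : R) :
  (2 <= q)%nat -> (1 <= M)%nat -> Nat.gcd M (q - 1) = 1%nat -> (e <= 1)%nat ->
  (forall ca a b, (ca <= 1)%nat ->
     diff_count q M n (r + ca) a - diff_count q M n (r + ca) b <= Y) ->
  diff_count q M (n * block q M) (r * block q M + (q + e)) l -
  diff_count q M (n * block q M) (r * block q M + (q + e)) l' <=
  (INR (block q M) - INR M) * Y.
Proof.
  intros Hq HM Hg He HY. unfold block. rewrite !diff_count_rec, <- rsum_minus by assumption.
  set (W := (q ^ (M + 2))%nat).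
  set (D := fun t => (q ^ (t + 1) - q)%nat).
  set (x := fun d => _ - _).
  assert (Hpow : forall t, (q <= q ^ (t + 1))%nat).
  { intros t. rewrite Nat.add_1_r. simpl.
    assert (q ^ t <> 0)%nat by (apply Nat.pow_nonzero; lia). nia. }
  (* The spare digits of [block] guarantee that no carry leaves it, even with [e = 1]. *)
  assert (HqW : forall t, (t < M)%nat -> (q ^ (t + 1) + 1 < W)%nat).
  { intros t Ht. unfold W.
    assert (q ^ (t + 1) <= q ^ M)%nat by (apply Nat.pow_le_mono_r; lia).
    assert (4 * q ^ M <= q ^ (M + 2))%nat.
    { rewrite Nat.pow_add_r, Nat.mul_comm. apply Nat.mul_le_mono_l. simpl. nia. }
    assert (1 <= q ^ M)%nat by (apply Nat.neq_0_lt_0, Nat.pow_nonzero; lia). lia. }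
  assert (Hx : forall d, (d < W)%nat -> 0 <= Y - x d).
  { intros d Hd. unfold x. fold W.
    assert (Hca : ((d + (q + e)) / W <= 1)%nat).
    { assert (q + e < W)%nat by (specialize (HqW 0%nat ltac:(lia)); simpl in HqW; lia).
      assert ((d + (q + e)) / W < 2)%nat by (apply Nat.Div0.div_lt_upper_bound; lia). lia. }
    specialize (HY _ (l + Z.of_nat (digit_sum q d) - Z.of_nat (digit_sum q ((d + (q + e)) mod W)))%Z
     (l' + Z.of_nat (digit_sum q d) - Z.of_nat (digit_sum q ((d + (q + e)) mod W)))%Z Hca). lra. }
  (* Since [Y - x d] is nonnegative it may be summed over the [D t] only; the [x (D t)] cancel in
     total, which gains [M * Y]. *)
  assert (HD : rsum M (fun t => Y - x (D t)) <= rsum W (fun d => Y - x d)).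
  { apply (rsum_injection_le W M D (fun d => Y - x d)).
    - intros t Ht. unfold D. specialize (HqW t Ht). lia.
    - intros s t Hs Ht E. unfold D in E. specialize (Hpow s) as Hs'. specialize (Hpow t) as Ht'.
      assert (E' : (q ^ (s + 1) = q ^ (t + 1))%nat) by lia.
      apply Nat.pow_inj_r in E'; lia.
    - exact Hx. }
  rewrite !rsum_minus, !rsum_const in HD.
  assert (Hxt : forall t, (t < M)%nat -> x (D t) =
     diff_count q M n r (l - Z.of_nat (1 + e) + Z.of_nat t * Z.of_nat (q - 1)) -
     diff_count q M n r (l' - Z.of_nat (1 + e) + Z.of_nat t * Z.of_nat (q - 1))).
  { intros t Ht. unfold x. fold W. specialize (HqW t Ht). specialize (Hpow t).
    assert (ED : (D t + (q + e) = 1 * q ^ (t + 1) + e)%nat) by (unfold D; lia).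
    rewrite ED, Nat.div_small, Nat.mod_small, Nat.add_0_r by lia.
    rewrite digit_sum_pow, (digit_sum_lt q 1), (digit_sum_lt q e) by lia.
    assert (Es : digit_sum q (D t) = (t * (q - 1))%nat).
    { unfold D. replace (q ^ (t + 1) - q)%nat with (q * (q ^ t - 1) + 0)%nat
        by (rewrite Nat.add_1_r; simpl; nia).
      rewrite digit_sum_step, digit_sum_pow_pred by lia. reflexivity. }
    rewrite Es. f_equal; f_equal; lia. }
  rewrite (rsum_ext M _ _ Hxt), rsum_minus in HD.
  rewrite (rsum_residues_invariant (diff_count q M n r) M (q - 1)
     (l - Z.of_nat (1 + e)) (l' - Z.of_nat (1 + e))) in HD;
    [|lia|exact Hg|intros; apply diff_count_periodic; lia].
  lra.
Qed.

(** The carry [e] is quantified inside the induction because the lower digits may or may not send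
    one, while the bound has to depend on [r] alone. Outside the distinguished digit block,
    averaging over [d] does not increase the oscillation. *)
Lemma diff_count_osc (q M j : nat) :
  (2 <= q)%nat -> (1 <= M)%nat -> Nat.gcd M (q - 1) = 1%nat ->
  forall r e l l', (e <= 1)%nat ->
  diff_count q M (block q M ^ j) (r + e) l - diff_count q M (block q M ^ j) (r + e) l'
  <= INR (block q M ^ j) * osc q M j r.
Proof.
  intros Hq HM Hg. destruct (block_bounds q M Hq) as [HMW HqW].
  induction j as [|j IH]; intros r e l l' He.
  - pose proof (diff_count_bounds q M 1 (r + e) l). pose proof (diff_count_bounds q M 1 (r + e) l').
    simpl in *. lra.
  - set (W := block q M) in *.
    replace (W ^ S j)%nat with (W ^ j * W)%nat by (simpl; lia).
    set (n := (W ^ j)%nat) in *. cbn [osc]. fold W.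
    set (r' := (r / W)%nat). set (e0 := (r mod W)%nat).
    assert (Er : r = (r' * W + e0)%nat) by (unfold r', e0; pose proof (Nat.div_mod_eq r W); lia).
    assert (He0 : (e0 < W)%nat) by (apply Nat.mod_upper_bound; lia).
    assert (HW' : 0 < INR W) by (apply lt_0_INR; lia).
    replace (r + e)%nat with (r' * W + (e0 + e))%nat by lia.
    rewrite mult_INR. destruct (Nat.eqb_spec e0 q) as [Eq|_].
    + rewrite Eq. unfold W. eapply Rle_trans.
      * apply good_block with (Y := INR n * osc q M j r'); try assumption.
        intros; apply IH; assumption.
      * fold W. apply Req_le. field. lra.
    + unfold W, block. rewrite !diff_count_rec by assumption. fold (block q M). fold W.
      rewrite <- rsum_minus.
      apply Rle_trans with (INR W * (INR n * osc q M j r')); [|apply Req_le; ring].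
      apply rsum_le_const; intros d Hd. apply IH.
      assert ((d + (e0 + e)) / W < 2)%nat by (apply Nat.Div0.div_lt_upper_bound; lia). lia.
Qed.

(** Comparison of one class with each of the [M] classes, whose counts add up to the whole block,
    turns the oscillation into an upper bound. *)
Lemma diff_count_uniform (q M j r e : nat) (l : Z) :
  (2 <= q)%nat -> (1 <= M)%nat -> Nat.gcd M (q - 1) = 1%nat -> (e <= 1)%nat ->
  diff_count q M (block q M ^ j) (r + e) l
  <= INR (block q M ^ j) * (/ INR M + osc q M j r).
Proof.
  intros Hq HM Hg He. assert (HM' : 0 < INR M) by (apply lt_0_INR; lia).
  set (n := (block q M ^ j)%nat).
  assert (H : INR M * (diff_count q M n (r + e) l - INR n * osc q M j r) <= INR n).
  { rewrite <- rsum_const. apply Rle_trans with (2 := Req_le _ _ (diff_count_total q M n (r + e) HM)).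
    apply rsum_le; intros t _.
    pose proof (diff_count_osc q M j Hq HM Hg r e l (Z.of_nat t) He) as Ho. fold n in Ho. lra. }
  apply Rmult_le_reg_l with (INR M); [lra|].
  replace (INR M * (INR n * (/ INR M + osc q M j r))) with
    (INR n + INR M * (INR n * osc q M j r)) by (field; lra). lra.
Qed.

(** * Correlations on a window *)

(** The [- 0] makes this literally the event counted by [diff_count] at the residue 0. *)
Definition same (q M n n' : nat) : bool :=
  divides_b (Z.of_nat (digit_sum q n) - Z.of_nat (digit_sum q n') - 0) M.

(** When [a + r] overflows [W] the low digits decide nothing, so the overflow counts as success. It
    concerns at most [r] of the residues [a] below [W]. *)
Definition same_trunc (q M W a r : nat) : bool :=
  same q M (a + r) a || Nat.leb W (a + r).

Lemma same_truncate (q M A x r : nat) : (2 <= q)%nat ->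
  same q M (x + r) x = true -> same_trunc q M (q ^ A) (x mod q ^ A) r = true.
Proof.
  intros Hq H. unfold same_trunc. apply orb_true_iff.
  destruct (Nat.leb_spec (q ^ A) (x mod q ^ A + r)) as [Hle|Hlt]; [right; reflexivity|left].
  pose proof (Nat.div_mod_eq x (q ^ A)) as E.
  unfold same in *. rewrite <- H.
  replace (x + r)%nat with (x / q ^ A * q ^ A + (x mod q ^ A + r))%nat by lia.
  assert (Ex : digit_sum q x = (digit_sum q (x / q ^ A) + digit_sum q (x mod q ^ A))%nat).
  { rewrite <- (digit_sum_pow q A) by (assumption || lia). f_equal. lia. }
  rewrite Ex, digit_sum_pow by assumption. f_equal. lia.
Qed.

Lemma same_trunc_count (q M j r e : nat) :
  (2 <= q)%nat -> (1 <= M)%nat -> Nat.gcd M (q - 1) = 1%nat -> (e <= 1)%nat ->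
  rsum (block q M ^ j) (fun a => indic (same_trunc q M (block q M ^ j) a (r + e)))
  <= INR (block q M ^ j) * (/ INR M + osc q M j r + (INR r + 1) / INR (block q M ^ j)).
Proof.
  intros Hq HM Hg He. set (W := (block q M ^ j)%nat).
  assert (HW : 0 < INR W).
  { apply lt_0_INR, Nat.neq_0_lt_0, Nat.pow_nonzero. destruct (block_bounds q M Hq). lia. }
  assert (H := diff_count_uniform q M j r e 0%Z Hq HM Hg He). fold W in H.
  assert (H2 : rsum W (fun a => indic (Nat.leb W (a + (r + e)))) <= INR (r + e)).
  { eapply Rle_trans; [|apply (rsum_indic_range W (r + e) W (r + e))].
    apply rsum_le; intros a Ha. apply indic_le. intros E. rewrite E. simpl.
    apply Nat.ltb_lt. lia. }
  assert (H3 : INR (r + e) <= INR r + 1).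
  { rewrite plus_INR. apply Rplus_le_compat_l. apply (le_INR e 1). lia. }
  apply Rle_trans with (diff_count q M W (r + e) 0 + INR (r + e)).
  - eapply Rle_trans; [|apply Rplus_le_compat_l, H2]. unfold diff_count.
    rewrite <- rsum_plus. apply rsum_le; intros a _. apply indic_orb_le.
  - rewrite Rmult_plus_distr_l.
    replace (INR W * ((INR r + 1) / INR W)) with (INR r + 1) by (field; lra). lra.
Qed.

(** An upper bound only asks for the injective half of the Chinese remainder theorem: a pair of
    residues comes from at most one [m]. *)
Lemma crt_sum_le (Q1 Q2 : nat) (x y : nat -> R) :
  (0 < Q1)%nat -> (0 < Q2)%nat -> Nat.gcd Q1 Q2 = 1%nat ->
  (forall a, 0 <= x a) -> (forall b, 0 <= y b) ->
  rsum (Q1 * Q2) (fun m => x (m mod Q1)%nat * y (m mod Q2)%nat) <= rsum Q1 x * rsum Q2 y.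
Proof.
  intros H1 H2 Hg Hx Hy. rewrite rsum_mul.
  rewrite (rsum_ext (Q1 * Q2) _ (fun m => rsum Q1 (fun a => rsum Q2 (fun b =>
    x a * y b * indic (Nat.eqb (m mod Q1) a && Nat.eqb (m mod Q2) b))))).
  - rewrite rsum_swap. apply rsum_le; intros a Ha. rewrite rsum_swap.
    apply rsum_le; intros b Hb. rewrite rsum_scal.
    rewrite <- (Rmult_1_r (x a * y b)) at 2.
    apply Rmult_le_compat_l; [apply Rmult_le_pos; auto|].
    apply rsum_indic_unique.
    assert (Hw : forall i j, (i <= j)%nat -> (j < Q1 * Q2)%nat ->
      (i mod Q1 = j mod Q1)%nat -> (i mod Q2 = j mod Q2)%nat -> i = j).
    { intros i j Hij Hj E1 E2.
      assert (D1 : Nat.divide Q1 (j - i)).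
      { exists (j / Q1 - i / Q1)%nat. pose proof (Nat.div_mod_eq i Q1). pose proof (Nat.div_mod_eq j Q1).
        rewrite Nat.mul_sub_distr_r. lia. }
      assert (D2 : Nat.divide Q2 (j - i)).
      { exists (j / Q2 - i / Q2)%nat. pose proof (Nat.div_mod_eq i Q2). pose proof (Nat.div_mod_eq j Q2).
        rewrite Nat.mul_sub_distr_r. lia. }
      destruct D1 as [d Ed].
      assert (D3 : Nat.divide Q2 d).
      { apply Nat.gauss with Q1; [|rewrite Nat.gcd_comm; exact Hg].
        rewrite Nat.mul_comm, <- Ed. exact D2. }
      destruct D3 as [e Ee]. subst d.
      destruct e; [lia|]. exfalso. nia. }
    intros i j Hi Hj E1 E2. apply andb_true_iff in E1, E2.
    destruct E1 as [A1 A2], E2 as [B1 B2]. apply Nat.eqb_eq in A1, A2, B1, B2.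
    destruct (Nat.le_ge_cases i j); [|symmetry]; apply Hw; congruence || lia.
  - intros m _.
    rewrite (rsum_ext Q1 _ (fun a => indic (Nat.eqb (m mod Q1) a) * (x a * y (m mod Q2)%nat))).
    + rewrite (rsum_single Q1 (m mod Q1) (fun a => x a * y (m mod Q2)%nat)); [reflexivity|].
      apply Nat.mod_upper_bound; lia.
    + intros a _.
      rewrite (rsum_ext Q2 _ (fun b => indic (Nat.eqb (m mod Q2) b) * (indic (Nat.eqb (m mod Q1) a) * x a * y b))).
      * rewrite (rsum_single Q2 (m mod Q2) (fun b => indic (Nat.eqb (m mod Q1) a) * x a * y b)); [ring|].
        apply Nat.mod_upper_bound; lia.
      * intros b _. rewrite indic_andb. ring.
Qed.

Lemma pow_coprime (a b n m : nat) : Nat.gcd a b = 1%nat -> Nat.gcd (a ^ n) (b ^ m) = 1%nat.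
Proof.
  intros H. assert (Hn : forall c d k, Nat.gcd c d = 1%nat -> Nat.gcd (c ^ k) d = 1%nat).
  { intros c d k Hcd. induction k as [|k IH]; simpl; [destruct d; reflexivity|].
    apply Nat.divide_1_r. set (g := Nat.gcd _ _).
    assert (G1 : Nat.divide g (c * c ^ k)) by apply Nat.gcd_divide_l.
    assert (G2 : Nat.divide g d) by apply Nat.gcd_divide_r.
    apply Nat.gauss in G1.
    - rewrite <- IH. apply Nat.gcd_greatest; assumption.
    - apply Nat.divide_1_r. rewrite <- Hcd. apply Nat.gcd_greatest.
      + apply Nat.gcd_divide_r.
      + eapply Nat.divide_trans; [apply Nat.gcd_divide_l|exact G2]. }
  apply Hn. rewrite Nat.gcd_comm. apply Hn. rewrite Nat.gcd_comm. exact H.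
Qed.

(** In the product of the two one-base bounds only the main terms are multiplied; beside an error
    term the other factor is bounded trivially, so the errors add. *)
Lemma same_trunc_pair_count (q1 q2 M1 M2 j1 j2 r e : nat) :
  (2 <= q1)%nat -> (2 <= q2)%nat -> (1 <= M1)%nat -> (1 <= M2)%nat ->
  Nat.gcd q1 q2 = 1%nat -> Nat.gcd M1 (q1 - 1) = 1%nat -> Nat.gcd M2 (q2 - 1) = 1%nat ->
  (e <= 1)%nat ->
  let Q1 := (block q1 M1 ^ j1)%nat in let Q2 := (block q2 M2 ^ j2)%nat in
  rsum (Q1 * Q2) (fun m => indic (same_trunc q1 M1 Q1 (m mod Q1) (r + e) &&
                                 same_trunc q2 M2 Q2 (m mod Q2) (r + e)))
  <= INR (Q1 * Q2) * (/ (INR M1 * INR M2) + osc q1 M1 j1 r + osc q2 M2 j2 r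
     + (INR r + 1) * (/ INR Q1 + / INR Q2)).
Proof.
  intros Hq1 Hq2 HM1 HM2 Hq Hg1 Hg2 He Q1 Q2.
  assert (HQ1 : (0 < Q1)%nat).
  { apply Nat.neq_0_lt_0, Nat.pow_nonzero. destruct (block_bounds q1 M1 Hq1). lia. }
  assert (HQ2 : (0 < Q2)%nat).
  { apply Nat.neq_0_lt_0, Nat.pow_nonzero. destruct (block_bounds q2 M2 Hq2). lia. }
  assert (Hgcd : Nat.gcd Q1 Q2 = 1%nat) by (apply pow_coprime, pow_coprime, Hq).
  rewrite (rsum_ext _ _ (fun m => indic (same_trunc q1 M1 Q1 (m mod Q1) (r + e)) *
     indic (same_trunc q2 M2 Q2 (m mod Q2) (r + e)))) by (intros; apply indic_andb).
  eapply Rle_trans.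
  { apply (crt_sum_le Q1 Q2 (fun a => indic (same_trunc q1 M1 Q1 a (r + e)))
      (fun b => indic (same_trunc q2 M2 Q2 b (r + e)))); try assumption; intros; apply indic_bounds. }
  assert (S1 := same_trunc_count q1 M1 j1 r e Hq1 HM1 Hg1 He).
  assert (S2 := same_trunc_count q2 M2 j2 r e Hq2 HM2 Hg2 He).
  fold Q1 in S1. fold Q2 in S2.
  set (s1 := rsum Q1 _) in *. set (s2 := rsum Q2 _) in *.
  assert (P1 : 0 <= s1) by (apply rsum_nonneg; intros; apply indic_bounds).
  assert (P2 : 0 <= s2 <= INR Q2).
  { split; [apply rsum_nonneg; intros; apply indic_bounds|].
    rewrite <- (Rmult_1_r (INR Q2)). apply rsum_le_const; intros; apply indic_bounds. }
  apply lt_INR in HQ1, HQ2. simpl in HQ1, HQ2.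
  assert (HM1' : 1 <= INR M1) by (apply (le_INR 1); lia).
  assert (HM2' : 1 <= INR M2) by (apply (le_INR 1); lia).
  pose proof (osc_bounds q1 M1 j1 r Hq1) as O1. pose proof (osc_bounds q2 M2 j2 r Hq2) as O2.
  rewrite mult_INR, Rinv_mult.
  assert (I1 : 0 < / INR M1 <= 1).
  { split; [apply Rinv_0_lt_compat; lra|]. rewrite <- Rinv_1. apply Rinv_le_contravar; lra. }
  assert (I2 : 0 < / INR M2) by (apply Rinv_0_lt_compat; lra).
  pose proof (pos_INR r).
  set (x := osc q1 M1 j1 r + (INR r + 1) / INR Q1).
  set (y := osc q2 M2 j2 r + (INR r + 1) / INR Q2).
  assert (Hx : 0 <= x).
  { unfold x. assert (0 <= (INR r + 1) / INR Q1).
    { apply Rmult_le_pos; [lra|left; apply Rinv_0_lt_compat; lra]. } lra. }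
  assert (Hy : 0 <= y).
  { unfold y. assert (0 <= (INR r + 1) / INR Q2).
    { apply Rmult_le_pos; [lra|left; apply Rinv_0_lt_compat; lra]. } lra. }
  replace (/ INR M1 * / INR M2 + osc q1 M1 j1 r + osc q2 M2 j2 r +
    (INR r + 1) * (/ INR Q1 + / INR Q2)) with (/ INR M1 * / INR M2 + x + y) by
    (unfold x, y; field; lra).
  assert (S1' : s1 <= INR Q1 * / INR M1 + INR Q1 * x) by (unfold x; lra).
  assert (S2' : s2 <= INR Q2 * / INR M2 + INR Q2 * y) by (unfold y; lra).
  apply Rle_trans with ((INR Q1 * / INR M1) * (INR Q2 * / INR M2 + INR Q2 * y) + (INR Q1 * x) * INR Q2).
  - apply Rle_trans with ((INR Q1 * / INR M1) * s2 + (INR Q1 * x) * s2); [nra|].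
    apply Rplus_le_compat; apply Rmult_le_compat_l; try lra; apply Rmult_le_pos; lra.
  - assert (0 <= INR Q1 * INR Q2 * y) by (apply Rmult_le_pos; nra). nra.
Qed.

(** * Integer parts under small perturbations *)

Ltac bool_to_prop :=
  repeat match goal with
  | H : (_ || _)%bool = false |- _ => apply orb_false_iff in H; destruct H
  | H : (_ || _)%bool = true |- _ => apply orb_true_iff in H
  | H : (_ && _)%bool = true |- _ => apply andb_true_iff in H; destruct H
  | H : (_ && _)%bool = false |- _ => apply andb_false_iff in H
  | H : Nat.leb _ _ = true |- _ => apply Nat.leb_le in H
  | H : Nat.leb _ _ = false |- _ => apply Nat.leb_gt in H
  | H : Nat.ltb _ _ = true |- _ => apply Nat.ltb_lt in H
  | H : Nat.ltb _ _ = false |- _ => apply Nat.ltb_ge in H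
  | H : _ \/ _ |- _ => destruct H
  end.

(* The positions [i] of the fractional part, in units of [1/X], at which an error
   of size [P] may change the integer part after adding [f / X]. *)
Definition unstable (X P f i : nat) : bool :=
  Nat.ltb i P || Nat.ltb (i + f) P || (Nat.leb X (i + f + P + 3) && Nat.ltb (i + f) (X + P))
  || Nat.leb (2 * X) (i + f + P + 3).

Lemma unstable_count (X P f : nat) : (f < X)%nat -> (1 <= P)%nat ->
  rsum X (fun i => indic (unstable X P f i)) <= 11 * INR P.
Proof.
  intros Hf HP.
  apply Rle_trans with (rsum X (fun i =>
    indic (Nat.leb 0 (i + 0) && Nat.ltb (i + 0) (0 + P)) +
    indic (Nat.leb 0 (i + f) && Nat.ltb (i + f) (0 + P)) +
    indic (Nat.leb X (i + (f + P + 3)) && Nat.ltb (i + (f + P + 3)) (X + (2 * P + 3))) +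
    indic (Nat.leb (2 * X) (i + (f + P + 3)) && Nat.ltb (i + (f + P + 3)) (2 * X + (P + 3))))).
  - apply rsum_le; intros i Hi. unfold unstable.
    eapply Rle_trans; [apply indic_orb_le|]. apply Rplus_le_compat.
    eapply Rle_trans; [apply indic_orb_le|]. apply Rplus_le_compat.
    eapply Rle_trans; [apply indic_orb_le|]. apply Rplus_le_compat.
    all: apply indic_le; intros H; bool_to_prop; apply andb_true_iff; split;
      (apply Nat.leb_le || apply Nat.ltb_lt); lia.
  - rewrite !rsum_plus.
    pose proof (rsum_indic_range X 0 0 P). pose proof (rsum_indic_range X f 0 P).
    pose proof (rsum_indic_range X (f + P + 3) X (2 * P + 3)).
    pose proof (rsum_indic_range X (f + P + 3) (2 * X) (P + 3)).
    rewrite !plus_INR, mult_INR in *. simpl (INR 2) in *. simpl (INR 3) in *.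
    apply (le_INR 1) in HP. simpl in HP. lra.
Qed.

(** In units of 1/X, [x + D] lies at or above [X * (m + r) + y + f - b] and less than [P + 2] beyond
    it: [P] from the drift of [D] and 1 from each rounding. If [y] and [y + f] keep clear of the
    thresholds, its integer part is decided by whether [y + f] reaches [X]. *)
Lemma stable_floor (X P f r b z y m : nat) (x D0 D : R) :
  (0 < X)%nat -> (b < P)%nat -> 0 <= x -> 0 <= D0 <= D -> INR X * D <= INR X * D0 + INR P ->
  nfloor (INR X * D0) = (X * r + f)%nat -> (f < X)%nat ->
  z = nfloor (INR X * x) -> (z + b = X * m + y)%nat -> (y < X)%nat ->
  unstable X P f y = false ->
  nfloor x = m /\ nfloor (x + D) = (m + (r + if Nat.ltb (y + f) X then 0 else 1))%nat.
Proof.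
  intros HX Hb Hx HD HXD He Hf Hz Hzb Hy Hst.
  assert (HX' : 0 < INR X) by (apply lt_0_INR; lia).
  destruct (nfloor_spec (INR X * D0)) as [E1 E2]; [nra|]. rewrite He in E1, E2.
  destruct (nfloor_spec (INR X * x)) as [Z1 Z2]; [nra|]. rewrite <- Hz in Z1, Z2.
  unfold unstable in Hst. bool_to_prop; try lia.
  all: assert (Hm : nfloor x = m) by
   (rewrite (nfloor_div x X Hx HX), <- Hz; symmetry; apply Nat.div_unique with (y - b)%nat; lia).
  all: split; [exact Hm|].
  all: apply nfloor_unique.
  all: apply (f_equal INR) in Hzb; rewrite !plus_INR, !mult_INR in *.
  all: rewrite ?plus_INR, ?mult_INR in E1, E2.
  all: match goal with |- context [Nat.ltb ?u ?v] => destruct (Nat.ltb_spec u v) as [L|L] end; try lia.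
  all: assert (Hb' : INR b + 1 <= INR P) by (rewrite <- S_INR; apply le_INR; lia).
  all: split; [apply Rmult_le_reg_l with (INR X)|apply Rmult_lt_reg_l with (INR X)]; try lra.
  all: pose proof (pos_INR b).
  all: repeat match goal with H : (_ < _)%nat |- _ => apply le_INR in H | H : (_ <= _)%nat |- _ => apply le_INR in H end.
  all: rewrite ?S_INR, ?plus_INR, ?mult_INR in *; simpl (INR 0) in *; simpl (INR 1) in *;
     simpl (INR 2) in *; simpl (INR 3) in *.
  all: nra.
Qed.

(** After positivity: increments drift by at most 1/P over the window; the curvature is constant up
    to a factor 1 + 1/P; for shifts from [h0] on, the increment winds at least 2P times around the
    circle of length [Q * (P * P)]; nearer shifts are a negligible share of [J]. *)
Definition window_ok (P J Q h0 : nat) (lam Lam : R) : Prop :=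
  0 < lam /\
  INR P ^ 3 * Lam * INR J <= 1 /\
  Lam * INR P <= lam * (INR P + 1) /\
  2 * INR (Q * (P * P)) * INR P <= INR (P * J) * INR (P * P) * lam * INR h0 /\
  (2 * h0 * (Q * (P * P)) <= J)%nat.

(** The increment is frozen at its value at the window start, so that a single [r] enters. With
    resolution [X = P^2] the unstable positions are a share 11 P / X, which gives 11/P; the last
    error is that of [equidistribution]. *)
Lemma window_correlation (q1 q2 M1 M2 j1 j2 P J h0 k : nat) (lam Lam : R) (phi : nat -> R) :
  (2 <= q1)%nat -> (2 <= q2)%nat -> (1 <= M1)%nat -> (1 <= M2)%nat ->
  Nat.gcd q1 q2 = 1%nat -> Nat.gcd M1 (q1 - 1) = 1%nat -> Nat.gcd M2 (q2 - 1) = 1%nat ->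
  (0 < P)%nat -> (0 < J)%nat -> (0 < h0)%nat -> (0 < k)%nat -> (k <= P)%nat ->
  (forall n, 0 <= phi n) -> (forall n h, phi n <= phi (n + h)%nat) ->
  second_slopes (2 * (P * J)) lam Lam phi ->
  let Q1 := (block q1 M1 ^ j1)%nat in let Q2 := (block q2 M2 ^ j2)%nat in
  window_ok P J (Q1 * Q2) h0 lam Lam ->
  let r := nfloor (phi k - phi 0%nat) in
  rsum (P * J) (fun i => indic (same q1 M1 (nfloor (phi (i + k)%nat)) (nfloor (phi i)) &&
                               same q2 M2 (nfloor (phi (i + k)%nat)) (nfloor (phi i))))
  <= INR (P * J) * (/ (INR M1 * INR M2) + osc q1 M1 j1 r + osc q2 M2 j2 r
     + (INR r + 1) * (/ INR Q1 + / INR Q2) + 11 / INR P + 5 / sqrt (INR P)).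
Proof.
  intros Hq1 Hq2 HM1 HM2 Hq Hg1 Hg2 HP HJ Hh0 Hk HkP Hphi0 Hmono Hsl Q1 Q2 Hok r.
  destruct Hok as [Hlam [C1 [C2 [C3 C5]]]].
  assert (HQ1 : (0 < Q1)%nat).
  { apply Nat.neq_0_lt_0, Nat.pow_nonzero. destruct (block_bounds q1 M1 Hq1). lia. }
  assert (HQ2 : (0 < Q2)%nat).
  { apply Nat.neq_0_lt_0, Nat.pow_nonzero. destruct (block_bounds q2 M2 Hq2). lia. }
  set (Q := (Q1 * Q2)%nat) in *. set (X := (P * P)%nat) in *.
  assert (HQ : (0 < Q)%nat) by (unfold Q; nia).
  assert (HX : (0 < X)%nat) by (unfold X; nia).
  assert (HP' : 1 <= INR P) by (apply (le_INR 1); lia).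
  assert (HJ' : 1 <= INR J) by (apply (le_INR 1); lia).
  assert (HQ' : 1 <= INR Q) by (apply (le_INR 1); lia).
  assert (HX' : INR X = INR P * INR P) by (unfold X; apply mult_INR).
  assert (HPJ : INR (P * J) = INR P * INR J) by apply mult_INR.
  set (D0 := phi k - phi 0%nat) in *.
  assert (HD0 : 0 <= D0) by (specialize (Hmono 0%nat k); simpl in Hmono; unfold D0; lra).
  set (e0 := nfloor (INR X * D0)). set (f := (e0 mod X)%nat).
  assert (Hf : (f < X)%nat) by (apply Nat.mod_upper_bound; lia).
  assert (He0 : e0 = (X * r + f)%nat).
  { unfold r. rewrite (nfloor_div D0 X HD0 HX). apply Nat.div_mod_eq. }
  set (shift := fun y => if Nat.ltb (y + f) X then 0%nat else 1%nat).
  set (good := fun m e => same_trunc q1 M1 Q1 (m mod Q1) (r + e) && same_trunc q2 M2 Q2 (m mod Q2) (r + e)).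
  (* A residue modulo [Q * X] codes the integer part modulo [Q] together with the fractional part in
     units of 1/X; the latter determines the carry [shift]. *)
  set (chi := fun v => indic (unstable X P f (v mod X) || good (v / X)%nat (shift (v mod X)%nat))).
  set (z := fun i => nfloor (INR X * phi i)).
  assert (Hpt : forall i, (i < P * J)%nat ->
    INR P * indic (same q1 M1 (nfloor (phi (i + k)%nat)) (nfloor (phi i)) &&
           same q2 M2 (nfloor (phi (i + k)%nat)) (nfloor (phi i)))
    <= rsum P (fun b => chi ((z i + b) mod (Q * X))%nat)).
  { intros i Hi. rewrite <- rsum_const. apply rsum_le; intros b Hb.
    unfold chi. apply indic_le. intros Hsame. apply orb_true_iff.
    rewrite (Nat.mul_comm Q X), Nat.Div0.mod_mul_r.
    set (y := ((z i + b) mod X)%nat). set (m := ((z i + b) / X)%nat).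
    assert (Hy : (y < X)%nat) by (apply Nat.mod_upper_bound; lia).
    replace ((y + X * (m mod Q)) mod X)%nat with y by
      (apply Nat.mod_unique with (m mod Q)%nat; lia).
    replace ((y + X * (m mod Q)) / X)%nat with (m mod Q)%nat by
      (apply Nat.div_unique with y; lia).
    destruct (unstable X P f y) eqn:Hst; [left; reflexivity|right].
    (* The drift is at most [Lam * k * i], hence at most [Lam * P * (P * J)]. By [C1] this is at
       most 1/P, which is [P] units of 1/X. *)
    assert (HD : D0 <= phi (i + k)%nat - phi i /\
       INR X * (phi (i + k)%nat - phi i) <= INR X * D0 + INR P).
    { destruct (Nat.eq_dec i 0) as [->|Hi0].
      - simpl. fold D0. split; lra.
      - destruct (Hsl k 0%nat i Hk ltac:(lia)) as [A1 A2]; [nia|].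
        simpl (0 + k)%nat in *. fold D0 in A1, A2. rewrite Nat.sub_0_r in *.
        assert (I1 : 0 <= INR i <= INR P * INR J).
        { split; [apply pos_INR|]. rewrite <- HPJ. apply le_INR. lia. }
        assert (I2 : 0 <= INR k <= INR P) by (split; [apply pos_INR|apply le_INR; lia]).
        assert (HLam : lam <= Lam).
        { assert (0 < INR k * INR i) by (apply Rmult_lt_0_compat; apply lt_0_INR; lia).
          apply Rmult_le_reg_r with (INR k * INR i); lra. }
        assert (Lam * INR k * INR i <= Lam * (INR P * (INR P * INR J))).
        { rewrite Rmult_assoc. apply Rmult_le_compat_l; [lra|]. apply Rmult_le_compat; lra. }
        assert (0 <= lam * INR k * INR i) by (apply Rmult_le_pos; [apply Rmult_le_pos|]; lra).
        split; [lra|].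
        assert (B1 : INR X * (phi (i + k)%nat - phi i) - INR X * D0 <= INR X * (Lam * (INR P * (INR P * INR J)))).
        { rewrite <- Rmult_minus_distr_l. apply Rmult_le_compat_l; [nra|lra]. }
        assert (B2 : INR X * (Lam * (INR P * (INR P * INR J))) <= INR P).
        { rewrite HX'. replace (INR P * INR P * (Lam * (INR P * (INR P * INR J)))) with
            (INR P * (INR P ^ 3 * Lam * INR J)) by ring. nra. }
        lra. }
    destruct HD as [HD1 HD2].
    destruct (stable_floor X P f r b (z i) y m (phi i) D0 (phi (i + k)%nat - phi i)
       HX Hb (Hphi0 i) ltac:(lra) HD2 He0 Hf eq_refl ltac:(apply Nat.div_mod_eq) Hy Hst) as [F1 F2].
    replace (phi i + (phi (i + k)%nat - phi i)) with (phi (i + k)%nat) in F2 by ring.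
    rewrite F1, F2 in Hsame. fold (shift y) in Hsame.
    apply andb_true_iff in Hsame. destruct Hsame as [S1 S2].
    unfold good. apply andb_true_iff. unfold Q.
    assert (R1 : ((m mod (Q1 * Q2)) mod Q1 = m mod Q1)%nat).
    { rewrite Nat.Div0.mod_mul_r, Nat.mul_comm, Nat.Div0.mod_add. apply Nat.Div0.mod_mod. }
    assert (R2 : ((m mod (Q1 * Q2)) mod Q2 = m mod Q2)%nat).
    { rewrite (Nat.mul_comm Q1), Nat.Div0.mod_mul_r, Nat.mul_comm, Nat.Div0.mod_add. apply Nat.Div0.mod_mod. }
    rewrite R1, R2. unfold Q1, Q2, block in *. rewrite <- !Nat.pow_mul_r in *.
    split; apply same_truncate; assumption. }
  assert (Heq := equidistribution P J Q X h0 lam Lam phi chi HP HJ).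
  assert (C1' : INR X * Lam * INR J * INR P <= 1).
  { rewrite HX'. replace (INR P * INR P * Lam * INR J * INR P) with (INR P ^ 3 * Lam * INR J) by ring.
    exact C1. }
  assert (C4 : 2 * INR (Q * X) * INR P <= INR (P * J)).
  { apply le_INR in C5. rewrite !mult_INR in C5. simpl (INR 2) in C5. rewrite HPJ, mult_INR.
    assert (1 <= INR h0) by (apply (le_INR 1); lia).
    assert (1 <= INR X) by (apply (le_INR 1); lia).
    assert (0 < INR Q * INR X) by (apply Rmult_lt_0_compat; lra).
    assert (1 * (INR Q * INR X) <= INR h0 * (INR Q * INR X)) by (apply Rmult_le_compat_r; lra).
    rewrite (Rmult_comm (INR P)). apply Rmult_le_compat_r; lra. }
  specialize (Heq ltac:(unfold X; nia) Hlam Hphi0 Hmono Hsl C1' C2 C3 C4 C5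
    ltac:(intros; apply indic_bounds)).
  assert (Hchi : rsum (Q * X) chi <= INR Q * (11 * INR P) + INR X * (INR Q *
     (/ (INR M1 * INR M2) + osc q1 M1 j1 r + osc q2 M2 j2 r + (INR r + 1) * (/ INR Q1 + / INR Q2)))).
  { rewrite rsum_prod.
    apply Rle_trans with (rsum Q (fun m => rsum X (fun y =>
      indic (unstable X P f y) + indic (good m (shift y))))).
    - apply rsum_le; intros m Hm. apply rsum_le; intros y Hy. unfold chi.
      replace ((m * X + y) mod X)%nat with y by (apply Nat.mod_unique with m; lia).
      replace ((m * X + y) / X)%nat with m by (apply Nat.div_unique with y; lia).
      apply indic_orb_le.
    - rewrite (rsum_ext Q _ (fun m => rsum X (fun y => indic (unstable X P f y)) +
         rsum X (fun y => indic (good m (shift y))))) by (intros; apply rsum_plus).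
      rewrite rsum_plus, rsum_const. apply Rplus_le_compat.
      + apply Rmult_le_compat_l; [lra|]. apply unstable_count; lia.
      + rewrite rsum_swap. apply rsum_le_const; intros y Hy. unfold good.
        apply same_trunc_pair_count; try assumption. unfold shift.
        destruct (Nat.ltb (y + f) X); lia. }
  set (B := / (INR M1 * INR M2) + osc q1 M1 j1 r + osc q2 M2 j2 r + (INR r + 1) * (/ INR Q1 + / INR Q2)) in *.
  assert (Hdiv : rsum (Q * X) chi / INR (Q * X) <= 11 / INR P + B).
  { apply Rmult_le_reg_r with (INR (Q * X)).
    - rewrite mult_INR, HX'. nra.
    - unfold Rdiv at 1. rewrite Rmult_assoc, Rinv_l, Rmult_1_r by (rewrite mult_INR, HX'; nra).
      eapply Rle_trans; [exact Hchi|]. rewrite mult_INR, HX'. apply Req_le. field. lra. }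
  apply Rmult_le_reg_l with (INR P); [lra|].
  rewrite <- rsum_scal.
  eapply Rle_trans; [apply rsum_le; exact Hpt|].
  eapply Rle_trans; [exact Heq|].
  replace (INR P * (INR (P * J) * (B + 11 / INR P + 5 / sqrt (INR P)))) with
    (INR (P * J) * INR P * (11 / INR P + B + 5 / sqrt (INR P))) by ring.
  apply Rmult_le_compat_l; [rewrite HPJ; apply Rmult_le_pos; nra|]. lra.
Qed.

(** * Correlations of n^c *)

Lemma Rpower_shift_derivable (c b t : R) : 0 < t + b ->
  derivable_pt_lim (fun s => Rpower (s + b) c) t (c * Rpower (t + b) (c - 1)).
Proof.
  intros H. rewrite <- (Rmult_1_r (c * _)).
  apply (derivable_pt_lim_comp (fun s => s + b) (fun s => Rpower s c)).
  - rewrite <- (Rplus_0_r 1). apply derivable_pt_lim_plus;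
      [apply derivable_pt_lim_id|apply derivable_pt_lim_const].
  - apply derivable_pt_lim_power. exact H.
Qed.

Lemma Rpower_mvt (c x h : R) : 0 < x -> 0 < h ->
  exists xi, x < xi < x + h /\ Rpower (x + h) c - Rpower x c = h * (c * Rpower xi (c - 1)).
Proof.
  intros Hx Hh.
  destruct (MVT_cor2 (fun t => Rpower t c) (fun t => c * Rpower t (c - 1)) x (x + h)) as [xi [E Hxi]].
  - lra.
  - intros t Ht. apply derivable_pt_lim_power. lra.
  - exists xi. split; [lra|]. rewrite E. ring.
Qed.

Lemma Rpower_mvt2 (c x a b : R) : 0 < x -> 0 < a -> 0 < b ->
  exists xi, x < xi < x + a + b /\
  (Rpower (x + a + b) c - Rpower (x + a) c) - (Rpower (x + b) c - Rpower x c) =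
  a * b * (c * (c - 1)) * Rpower xi (c - 2).
Proof.
  intros Hx Ha Hb.
  destruct (MVT_cor2 (fun t => Rpower (t + b) c - Rpower t c)
    (fun t => c * Rpower (t + b) (c - 1) - c * Rpower t (c - 1)) x (x + a)) as [xi [E Hxi]].
  - lra.
  - intros t Ht. apply derivable_pt_lim_minus.
    + apply Rpower_shift_derivable. lra.
    + apply derivable_pt_lim_power. lra.
  - destruct (Rpower_mvt (c - 1) xi b) as [eta [Heta E2]]; [lra|lra|].
    exists eta. split; [lra|].
    replace (c - 1 - 1) with (c - 2) in E2 by ring. rewrite E.
    replace (c * Rpower (xi + b) (c - 1) - c * Rpower xi (c - 1)) with
      (c * (Rpower (xi + b) (c - 1) - Rpower xi (c - 1))) by ring.
    rewrite E2. ring.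
Qed.

Lemma Rpower_pos (x y : R) : 0 < Rpower x y.
Proof. apply exp_pos. Qed.

Lemma Rpower_antitone (x y s : R) : s <= 0 -> 0 < x <= y -> Rpower y s <= Rpower x s.
Proof.
  intros Hs H. replace s with (- (- s)) by ring. rewrite !(Rpower_Ropp _ (- s)).
  apply Rinv_le_contravar; [apply Rpower_pos|]. apply Rle_Rpower_l; lra.
Qed.

Lemma Rpower_ratio (x y s : R) : -1 <= s -> 0 < x <= y -> Rpower x s * x <= Rpower y s * y.
Proof.
  intros Hs H. rewrite <- (Rpower_1 x) at 2 by lra. rewrite <- (Rpower_1 y) at 2 by lra.
  rewrite <- !Rpower_plus. apply Rle_Rpower_l; lra.
Qed.

(** The second derivative of x^c. *)
Definition curv (c x : R) : R := c * (c - 1) * Rpower x (c - 2).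

Lemma curv_pos (c x : R) : 1 < c -> 0 < curv c x.
Proof. intros. unfold curv. apply Rmult_lt_0_compat; [nra|apply Rpower_pos]. Qed.

Lemma curv_antitone (c x y : R) : 1 < c < 2 -> 0 < x <= y -> curv c y <= curv c x.
Proof.
  intros Hc H. unfold curv. apply Rmult_le_compat_l; [nra|]. apply Rpower_antitone; lra.
Qed.

(** The product has exponent c - 1 > 0. Together with [curv_antitone] this confines the curvature on
    an interval to a factor [y / x]. *)
Lemma curv_ratio (c x y : R) : 1 < c < 2 -> 0 < x <= y -> curv c x * x <= curv c y * y.
Proof.
  intros Hc H. unfold curv. rewrite !(Rmult_assoc (c * (c - 1))).
  apply Rmult_le_compat_l; [nra|]. apply Rpower_ratio; lra.
Qed.

Definition npow (c : R) (n : nat) : R := Rpower (INR n) c.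

Lemma npow_second_difference (c : R) (n m h lo hi : nat) : 1 < c < 2 ->
  (0 < lo)%nat -> (lo <= n)%nat -> (n < m)%nat -> (0 < h)%nat -> (m + h <= hi)%nat ->
  curv c (INR hi) * INR h * INR (m - n) <=
  (npow c (m + h) - npow c m) - (npow c (n + h) - npow c n) <=
  curv c (INR lo) * INR h * INR (m - n).
Proof.
  intros Hc Hlo Hn Hnm Hh Hhi. unfold npow.
  assert (Ha : 0 < INR (m - n)) by (apply lt_0_INR; lia).
  assert (Hb : 0 < INR h) by (apply lt_0_INR; lia).
  assert (Hl : 0 < INR lo) by (apply lt_0_INR; lia).
  assert (Hln : INR lo <= INR n) by (apply le_INR; lia).
  assert (Hmh : INR (m + h) <= INR hi) by (apply le_INR; lia).
  replace (INR (m + h)) with (INR n + INR (m - n) + INR h) in * by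
    (rewrite <- !plus_INR; f_equal; lia).
  replace (INR m) with (INR n + INR (m - n)) by (rewrite <- plus_INR; f_equal; lia).
  rewrite plus_INR.
  destruct (Rpower_mvt2 c (INR n) (INR (m - n)) (INR h)) as [xi [Hxi E]]; try lra.
  rewrite E.
  pose proof (curv_antitone c (INR lo) xi Hc ltac:(lra)) as A1.
  pose proof (curv_antitone c xi (INR hi) Hc ltac:(lra)) as A2.
  replace (INR (m - n) * INR h * (c * (c - 1)) * Rpower xi (c - 2)) with
    (curv c xi * INR h * INR (m - n)) by (unfold curv; ring).
  split; repeat (apply Rmult_le_compat_r; [lra|]); assumption.
Qed.

Lemma npow_nonneg (c : R) (n : nat) : 0 <= npow c n.
Proof. left; apply Rpower_pos. Qed.

Lemma npow_mono (c : R) (n h : nat) : 0 < c -> (0 < n)%nat -> npow c n <= npow c (n + h).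
Proof.
  intros Hc Hn. apply Rle_Rpower_l; [lra|]. split; [apply lt_0_INR; lia|apply le_INR; lia].
Qed.

Lemma npow_difference (c : R) (n h hi : nat) : 1 < c -> (0 < n)%nat -> (0 < h)%nat -> (n + h <= hi)%nat ->
  npow c (n + h) - npow c n <= INR h * (c * Rpower (INR hi) (c - 1)).
Proof.
  intros Hc Hn Hh Hhi. unfold npow. rewrite plus_INR.
  assert (0 < INR n) by (apply lt_0_INR; lia).
  assert (0 < INR h) by (apply lt_0_INR; lia).
  apply le_INR in Hhi. rewrite plus_INR in Hhi.
  destruct (Rpower_mvt c (INR n) (INR h)) as [xi [Hxi E]]; try lra. rewrite E.
  apply Rmult_le_compat_l; [lra|]. apply Rmult_le_compat_l; [lra|]. apply Rle_Rpower_l; lra.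
Qed.

(** The second condition makes windows of length P J so short against N/P that the curvature varies
    by a factor of at most 1 + 1/P. The conditions with 9 keep the share of overflowing residues at
    most 1/P in each base. The last two make the average of [osc] over the windows of order 1/P;
    [eps1] and [eps2] stand for its mean over a full period. *)
Definition params_ok (c : R) (N P J Q1 Q2 h0 : nat) (eps1 eps2 : R) : Prop :=
  let kap := curv c (INR N) in let Q := (Q1 * Q2)%nat in
  kap * INR P ^ 3 * INR J <= 1 /\
  (2 * (P * J) * P <= N)%nat /\
  8 * INR Q <= INR J * kap * INR h0 /\
  (2 * h0 * (Q * (P * P)) <= J)%nat /\
  9 * INR P ^ 2 * Rpower (INR N) (c - 1) <= INR Q1 /\
  9 * INR P ^ 2 * Rpower (INR N) (c - 1) <= INR Q2 /\
  10 * eps1 * (INR N + INR Q1 / kap) <= INR N / INR P /\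
  10 * eps2 * (INR N + INR Q2 / kap) <= INR N / INR P.

Lemma curv_quarter (c : R) (N n : nat) : 1 < c < 2 -> (0 < N)%nat -> (N <= n <= 4 * N)%nat ->
  curv c (INR N) / 4 <= curv c (INR n) <= curv c (INR N).
Proof.
  intros Hc HN Hn. assert (0 < INR N) by (apply lt_0_INR; lia).
  assert (INR N <= INR n) by (apply le_INR; lia).
  assert (INR n <= 4 * INR N).
  { replace 4 with (INR 4) by (simpl; ring). rewrite <- mult_INR. apply le_INR; lia. }
  split; [|apply curv_antitone; lra].
  pose proof (curv_ratio c (INR N) (INR n) Hc ltac:(lra)) as A.
  pose proof (curv_pos c (INR n) ltac:(lra)).
  apply Rmult_le_reg_r with (INR N); [lra|]. nra.
Qed.

(** From one window start to the next the increment grows by between [t / 4] and [t], where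
    [t = k * T * kap], so its integer parts sweep through aligned blocks of length [Q]. The term
    with [Q / kap] stems from the two incomplete blocks. *)
Lemma osc_window_sum (c : R) (q M j N P T Jw n1 k : nat) (eps : R) :
  1 < c < 2 -> (2 <= q)%nat -> (0 < N)%nat -> (0 < T)%nat -> (0 < k)%nat -> (k <= P)%nat ->
  (N <= n1)%nat -> (n1 + Jw * T + k <= 4 * N)%nat ->
  curv c (INR N) * INR P * INR T <= 1 ->
  (INR (block q M) - INR M / INR (block q M)) ^ j <= INR (block q M ^ j) * eps ->
  0 <= eps ->
  INR T * rsum Jw (fun w => osc q M j (nfloor (npow c (n1 + w * T + k) - npow c (n1 + w * T))))
  <= 5 * eps * (INR (Jw * T) + 2 * (INR (block q M ^ j) / curv c (INR N))).
Proof.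
  intros Hc Hq HN HT Hk HkP Hn1 Hrange Hsmall Heps He0.
  set (Q := (block q M ^ j)%nat) in *. set (kap := curv c (INR N)) in *.
  assert (HQ : (0 < Q)%nat).
  { apply Nat.neq_0_lt_0, Nat.pow_nonzero. destruct (block_bounds q M Hq). lia. }
  assert (HQ' : 0 < INR Q) by (apply lt_0_INR; lia).
  assert (HT' : 0 < INR T) by (apply lt_0_INR; lia).
  assert (Hk' : 1 <= INR k) by (apply (le_INR 1); lia).
  assert (HkP' : INR k <= INR P) by (apply le_INR; lia).
  assert (Hkap : 0 < kap) by (apply curv_pos; lra).
  set (t := INR k * INR T * kap).
  assert (Ht : 0 < t) by (unfold t; apply Rmult_lt_0_compat; nra).
  assert (Ht1 : t <= 1).
  { apply Rle_trans with (kap * INR P * INR T); [|exact Hsmall]. unfold t.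
    replace (INR k * INR T * kap) with (INR k * (INR T * kap)) by ring.
    replace (kap * INR P * INR T) with (INR P * (INR T * kap)) by ring.
    apply Rmult_le_compat_r; nra. }
  assert (HJ0 := pos_INR Jw).
  assert (H := slopes_floor_sum Jw Q (t / 4) t (INR Q * eps)
    (fun w => npow c (n1 + w * T + k) - npow c (n1 + w * T)) (osc q M j) HQ ltac:(lra) ltac:(lra)).
  assert (H' : rsum Jw (fun w => osc q M j (nfloor (npow c (n1 + w * T + k) - npow c (n1 + w * T))))
     <= (t * INR Jw / INR Q + 2) * (/ (t / 4) + 1) * (INR Q * eps)).
  { apply H.
    - intros w. pose proof (npow_mono c (n1 + w * T) k ltac:(lra) ltac:(lia)). lra.
    - intros w v Hwv Hv.
      assert (HvT : (v * T + T <= Jw * T)%nat) by nia.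
      assert (HwT : (w * T < v * T)%nat) by nia.
      destruct (npow_second_difference c (n1 + w * T) (n1 + v * T) k N (4 * N) Hc) as [A1 A2]; try lia.
      destruct (curv_quarter c N (4 * N) Hc HN ltac:(lia)) as [B1 _]. fold kap in B1, A2.
      replace (n1 + v * T - (n1 + w * T))%nat with ((v - w) * T)%nat in * by nia.
      rewrite (mult_INR (v - w) T) in *.
      assert (0 <= INR k * (INR (v - w) * INR T)).
      { repeat apply Rmult_le_pos; apply pos_INR. }
      assert (kap / 4 * (INR k * (INR (v - w) * INR T)) <=
        curv c (INR (4 * N)) * (INR k * (INR (v - w) * INR T))) by (apply Rmult_le_compat_r; lra).
      unfold t. split; lra.
    - intros x. apply osc_bounds; exact Hq.
    - intros y. unfold Q. rewrite osc_block_sum by exact Hq. exact Heps. }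
  apply Rle_trans with (INR T * ((t * INR Jw / INR Q + 2) * (/ (t / 4) + 1) * (INR Q * eps))).
  { apply Rmult_le_compat_l; lra. }
  assert (Hit : / (t / 4) + 1 <= 5 / t).
  { apply Rmult_le_reg_r with t; [lra|]. field_simplify; lra. }
  assert (Hq0 : 0 <= t * INR Jw / INR Q + 2).
  { assert (0 <= t * INR Jw / INR Q).
    { apply Rmult_le_pos; [nra|left; apply Rinv_0_lt_compat; lra]. } lra. }
  apply Rle_trans with (INR T * ((t * INR Jw / INR Q + 2) * (5 / t) * (INR Q * eps))).
  { apply Rmult_le_compat_l; [lra|]. apply Rmult_le_compat_r; [nra|].
    apply Rmult_le_compat_l; lra. }
  replace (INR T * ((t * INR Jw / INR Q + 2) * (5 / t) * (INR Q * eps))) with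
    (5 * eps * (INR (Jw * T) + 2 * (INR Q / kap / INR k))).
  2:{ rewrite mult_INR. unfold t. field. repeat split; lra. }
  apply Rmult_le_compat_l; [lra|]. apply Rplus_le_compat_l. apply Rmult_le_compat_l; [lra|].
  assert (HQk : 0 <= INR Q / kap) by (apply Rmult_le_pos; [lra|left; apply Rinv_0_lt_compat; lra]).
  rewrite <- (Rmult_1_r (INR Q / kap)) at 2. apply Rmult_le_compat_l; [exact HQk|].
  rewrite <- Rinv_1. apply Rinv_le_contravar; lra.
Qed.

Lemma shifted_correlation (c : R) (q1 q2 M1 M2 j1 j2 N P J h0 n1 k : nat) (eps1 eps2 : R) :
  1 < c < 2 ->
  (2 <= q1)%nat -> (2 <= q2)%nat -> (1 <= M1)%nat -> (1 <= M2)%nat ->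
  Nat.gcd q1 q2 = 1%nat -> Nat.gcd M1 (q1 - 1) = 1%nat -> Nat.gcd M2 (q2 - 1) = 1%nat ->
  (0 < N)%nat -> (0 < P)%nat -> (0 < J)%nat -> (0 < h0)%nat -> (0 < k)%nat -> (k <= P)%nat ->
  (N <= n1 <= N + P)%nat -> 0 <= eps1 -> 0 <= eps2 ->
  let Q1 := (block q1 M1 ^ j1)%nat in let Q2 := (block q2 M2 ^ j2)%nat in
  (INR (block q1 M1) - INR M1 / INR (block q1 M1)) ^ j1 <= INR Q1 * eps1 ->
  (INR (block q2 M2) - INR M2 / INR (block q2 M2)) ^ j2 <= INR Q2 * eps2 ->
  params_ok c N P J Q1 Q2 h0 eps1 eps2 ->
  rsum N (fun i => indic (same q1 M1 (nfloor (npow c (n1 + i + k))) (nfloor (npow c (n1 + i))) &&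
                        same q2 M2 (nfloor (npow c (n1 + i + k))) (nfloor (npow c (n1 + i)))))
  <= INR N / (INR M1 * INR M2) + 40 * INR N / sqrt (INR P).
Proof.
  intros Hc Hq1 Hq2 HM1 HM2 Hq Hg1 Hg2 HN HP HJ Hh0 Hk HkP Hn1 He1 He2 Q1 Q2 HE1 HE2 Hok.
  destruct Hok as [p1 [p2 [p3 [p4 [p5 [p5' [p6 p7]]]]]]].
  set (kap := curv c (INR N)) in *. set (T := (P * J)%nat) in *.
  assert (HT : (0 < T)%nat) by (unfold T; nia).
  assert (HPT : (P <= T)%nat) by (unfold T; nia).
  assert (HTN : (2 * T <= N)%nat) by nia.
  (* One window more than fits, so that the windows cover the range; the overshoot is at most [T],
     hence at most N/(2P). *)
  set (Jw := (N / T + 1)%nat).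
  assert (HJw : (N < Jw * T)%nat /\ (Jw * T <= N + T)%nat).
  { unfold Jw. pose proof (Nat.div_mod_eq N T). pose proof (Nat.mod_upper_bound N T ltac:(lia)). nia. }
  assert (HN' : 0 < INR N) by (apply lt_0_INR; lia).
  assert (HT' : 0 < INR T) by (apply lt_0_INR; lia).
  assert (HP' : 1 <= INR P) by (apply (le_INR 1); lia).
  assert (HJ' : 1 <= INR J) by (apply (le_INR 1); lia).
  assert (Hkap : 0 < kap) by (apply curv_pos; lra).
  assert (HM1' : 1 <= INR M1) by (apply (le_INR 1); lia).
  assert (HM2' : 1 <= INR M2) by (apply (le_INR 1); lia).
  assert (HQ1 : 0 < INR Q1).
  { apply lt_0_INR, Nat.neq_0_lt_0, Nat.pow_nonzero. destruct (block_bounds q1 M1 Hq1). lia. }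
  assert (HQ2 : 0 < INR Q2).
  { apply lt_0_INR, Nat.neq_0_lt_0, Nat.pow_nonzero. destruct (block_bounds q2 M2 Hq2). lia. }
  set (body := fun i => indic (same q1 M1 (nfloor (npow c (n1 + i + k))) (nfloor (npow c (n1 + i))) &&
                        same q2 M2 (nfloor (npow c (n1 + i + k))) (nfloor (npow c (n1 + i))))).
  set (rw := fun w => nfloor (npow c (n1 + w * T + k) - npow c (n1 + w * T))).
  assert (HTeq : INR T = INR P * INR J) by apply mult_INR.
  (* The 13 is 11 from unstable positions plus 1 for the overflow in each base. *)
  assert (Hwin : forall w, (w < Jw)%nat ->
    rsum T (fun i => body (w * T + i)%nat) <= INR T * (/ (INR M1 * INR M2) + osc q1 M1 j1 (rw w)
      + osc q2 M2 j2 (rw w) + 13 / INR P + 5 / sqrt (INR P))).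
  { intros w Hw. set (n0 := (n1 + w * T)%nat).
    assert (Hn0 : (N <= n0)%nat /\ (n0 + 2 * T <= 4 * N)%nat).
    { unfold n0. assert (w * T + T <= Jw * T)%nat by nia. lia. }
    set (phi := fun i => npow c (n0 + i)).
    assert (Hb := window_correlation q1 q2 M1 M2 j1 j2 P J h0 k (curv c (INR (n0 + 2 * T)))
       (curv c (INR n0)) phi Hq1 Hq2 HM1 HM2 Hq Hg1 Hg2 HP HJ Hh0 Hk HkP).
    destruct (curv_quarter c N n0 Hc HN ltac:(lia)) as [_ K1].
    destruct (curv_quarter c N (n0 + 2 * T) Hc HN ltac:(lia)) as [K2 _].
    fold kap in K1, K2.
    assert (HPJ0 : 0 <= INR P ^ 3 * INR J) by (apply Rmult_le_pos; [apply pow_le|]; lra).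
    specialize (Hb ltac:(intros; apply npow_nonneg)).
    specialize (Hb ltac:(intros i h; unfold phi; rewrite Nat.add_assoc; apply npow_mono; [lra|lia])).
    assert (Hs : second_slopes (2 * (P * J)) (curv c (INR (n0 + 2 * T))) (curv c (INR n0)) phi).
    { intros h n m Hh Hnm Hm. unfold phi. rewrite !Nat.add_assoc.
      replace (m - n)%nat with (n0 + m - (n0 + n))%nat by lia.
      apply npow_second_difference; [exact Hc|lia|lia|lia|lia|unfold T; lia]. }
    specialize (Hb Hs). cbv zeta in Hb. fold Q1 Q2 T in Hb.
    assert (Hwok : window_ok P J (Q1 * Q2) h0 (curv c (INR (n0 + 2 * T))) (curv c (INR n0))).
    { split; [|split; [|split; [|split]]].
      - apply curv_pos; lra.
      - apply Rle_trans with (kap * (INR P ^ 3 * INR J)); [|lra].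
        replace (INR P ^ 3 * curv c (INR n0) * INR J) with (curv c (INR n0) * (INR P ^ 3 * INR J)) by ring.
        apply Rmult_le_compat_r; lra.
      - assert (Hn0' : 0 < INR n0) by (apply lt_0_INR; lia).
        pose proof (curv_ratio c (INR n0) (INR (n0 + 2 * T)) Hc
          ltac:(split; [lra|apply le_INR; lia])) as Hr.
        assert (HPn : INR P * INR (n0 + 2 * T) <= (INR P + 1) * INR n0).
        { rewrite <- S_INR, <- !mult_INR. apply le_INR. nia. }
        pose proof (curv_pos c (INR (n0 + 2 * T)) ltac:(lra)).
        apply Rmult_le_reg_r with (INR n0); [lra|].
        apply Rle_trans with (curv c (INR (n0 + 2 * T)) * (INR P * INR (n0 + 2 * T))); [nra|].
        rewrite Rmult_assoc. apply Rmult_le_compat_l; lra.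
      - rewrite !mult_INR in *.
        assert (A1 : 8 * (INR Q1 * INR Q2) <= INR J * (4 * curv c (INR (n0 + 2 * T))) * INR h0).
        { eapply Rle_trans; [exact p3|]. apply Rmult_le_compat_r; [apply pos_INR|].
          apply Rmult_le_compat_l; lra. }
        assert (0 <= INR P * (INR P * INR P)) by (apply Rmult_le_pos; nra).
        nra.
      - exact p4. }
    specialize (Hb Hwok). unfold phi in Hb. rewrite Nat.add_0_r in Hb.
    change (nfloor (npow c (n0 + k) - npow c n0)) with (rw w) in Hb.
    rewrite (rsum_ext T _ (fun i =>
      indic (same q1 M1 (nfloor (npow c (n0 + (i + k)))) (nfloor (npow c (n0 + i))) &&
             same q2 M2 (nfloor (npow c (n0 + (i + k)))) (nfloor (npow c (n0 + i)))))).
    2:{ intros i _. unfold body. rewrite !Nat.add_assoc. reflexivity. }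
    eapply Rle_trans; [exact Hb|].
    apply Rmult_le_compat_l; [lra|].
    assert (Hr0 : 0 <= npow c (n0 + k) - npow c n0).
    { pose proof (npow_mono c n0 k ltac:(lra) ltac:(lia)). lra. }
    (* Here [c < 2] and 4^(c-1) <= 4 give 8, and the added unit gives 9. *)
    assert (Hr : INR (rw w) + 1 <= 9 * INR P * Rpower (INR N) (c - 1)).
    { destruct (nfloor_spec _ Hr0) as [R1 _]. unfold rw. fold n0.
      pose proof (npow_difference c n0 k (4 * N) ltac:(lra) ltac:(lia) Hk ltac:(lia)) as R2.
      assert (R3 : Rpower (INR (4 * N)) (c - 1) <= 4 * Rpower (INR N) (c - 1)).
      { rewrite mult_INR, <- Rpower_mult_distr by (simpl; lra).
        apply Rmult_le_compat_r; [left; apply Rpower_pos|].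
        replace (INR 4) with 4 by (simpl; ring). rewrite <- (Rpower_1 4) at 2 by lra.
        apply Rle_Rpower; lra. }
      assert (R4 : 1 <= Rpower (INR N) (c - 1)).
      { rewrite <- (Rpower_O (INR N)) at 1 by lra. apply Rle_Rpower; [apply (le_INR 1); lia|lra]. }
      assert (R5 : INR k <= INR P) by (apply le_INR; lia).
      assert (R6 : INR k * (c * Rpower (INR (4 * N)) (c - 1)) <= INR P * (2 * (4 * Rpower (INR N) (c - 1)))).
      { pose proof (Rpower_pos (INR (4 * N)) (c - 1)).
        apply Rmult_le_compat; [apply pos_INR|nra|exact R5|].
        apply Rmult_le_compat; lra. }
      nra. }
    assert (Hi : forall Qi, 0 < Qi -> 9 * INR P ^ 2 * Rpower (INR N) (c - 1) <= Qi ->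
      (INR (rw w) + 1) * / Qi <= / INR P).
    { intros Qi HQi Hle. apply Rmult_le_reg_r with (Qi * INR P); [nra|].
      replace ((INR (rw w) + 1) * / Qi * (Qi * INR P)) with ((INR (rw w) + 1) * INR P) by (field; lra).
      replace (/ INR P * (Qi * INR P)) with Qi by (field; lra). nra. }
    pose proof (Hi (INR Q1) HQ1 p5). pose proof (Hi (INR Q2) HQ2 p5').
    unfold Rdiv. lra. }
  assert (Hsum : rsum N body <= rsum Jw (fun w => rsum T (fun i => body (w * T + i)%nat))).
  { rewrite <- rsum_prod. replace (Jw * T)%nat with (N + (Jw * T - N))%nat by lia.
    rewrite rsum_app. assert (0 <= rsum (Jw * T - N) (fun i => body (N + i)%nat)).
    { apply rsum_nonneg; intros; apply indic_bounds. } lra. }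
  assert (HTk : kap * INR P * INR T <= 1).
  { rewrite HTeq. assert (0 <= kap * INR P ^ 2 * INR J) by (apply Rmult_le_pos; nra).
    replace (kap * INR P * (INR P * INR J)) with (kap * INR P ^ 2 * INR J) by ring.
    replace (kap * INR P ^ 3 * INR J) with (kap * INR P ^ 2 * INR J * INR P) in p1 by ring. nra. }
  assert (O1 := osc_window_sum c q1 M1 j1 N P T Jw n1 k eps1 Hc Hq1 HN HT Hk HkP
    ltac:(lia) ltac:(lia) HTk HE1 He1).
  assert (O2 := osc_window_sum c q2 M2 j2 N P T Jw n1 k eps2 Hc Hq2 HN HT Hk HkP
    ltac:(lia) ltac:(lia) HTk HE2 He2).
  fold Q1 in O1. fold Q2 in O2. fold kap in O1, O2.
  change (fun w => osc q1 M1 j1 _) with (fun w => osc q1 M1 j1 (rw w)) in O1.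
  change (fun w => osc q2 M2 j2 _) with (fun w => osc q2 M2 j2 (rw w)) in O2.
  destruct HJw as [HJw1 HJw2]. apply le_INR in HJw2. rewrite plus_INR in HJw2.
  assert (HTP : INR T <= INR N / INR P / 2).
  { apply le_INR in p2. rewrite !mult_INR in p2. simpl (INR 2) in p2.
    apply Rmult_le_reg_r with (2 * INR P); [lra|]. field_simplify; lra. }
  assert (HNP : INR N / INR P <= INR N).
  { apply Rmult_le_reg_r with (INR P); [lra|]. field_simplify; nra. }
  assert (HJT : INR (Jw * T) <= 2 * INR N) by lra.
  assert (B1 : 5 * eps1 * (INR (Jw * T) + 2 * (INR Q1 / kap)) <= INR N / INR P).
  { eapply Rle_trans; [|exact p6]. fold kap.
    replace (10 * eps1 * (INR N + INR Q1 / kap)) with (5 * eps1 * (2 * INR N + 2 * (INR Q1 / kap))) by ring.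
    apply Rmult_le_compat_l; lra. }
  assert (B2 : 5 * eps2 * (INR (Jw * T) + 2 * (INR Q2 / kap)) <= INR N / INR P).
  { eapply Rle_trans; [|exact p7]. fold kap.
    replace (10 * eps2 * (INR N + INR Q2 / kap)) with (5 * eps2 * (2 * INR N + 2 * (INR Q2 / kap))) by ring.
    apply Rmult_le_compat_l; lra. }
  assert (HsP : 1 <= sqrt (INR P)) by (rewrite <- sqrt_1; apply sqrt_le_1_alt; lra).
  assert (HsP2 : sqrt (INR P) * sqrt (INR P) = INR P) by (apply sqrt_sqrt; lra).
  assert (HiP : 0 < / INR P <= / sqrt (INR P)).
  { split; [apply Rinv_0_lt_compat; lra|]. apply Rinv_le_contravar; [lra|].
    assert (sqrt (INR P) * 1 <= sqrt (INR P) * sqrt (INR P)) by (apply Rmult_le_compat_l; lra). lra. }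
  set (s := / sqrt (INR P)) in *.
  eapply Rle_trans; [exact Hsum|].
  eapply Rle_trans; [apply rsum_le; exact Hwin|].
  rewrite rsum_scal.
  rewrite (rsum_ext Jw _ (fun w => osc q1 M1 j1 (rw w) + osc q2 M2 j2 (rw w) +
    (/ (INR M1 * INR M2) + 13 / INR P + 5 / sqrt (INR P)))) by (intros; ring).
  rewrite !rsum_plus, !rsum_const, !Rmult_plus_distr_l.
  replace (INR T * (INR Jw * (/ (INR M1 * INR M2)))) with (INR (Jw * T) * / (INR M1 * INR M2)) by
    (rewrite mult_INR; ring).
  replace (INR T * (INR Jw * (13 / INR P))) with (INR (Jw * T) * (13 * / INR P)) by
    (rewrite mult_INR; unfold Rdiv; ring).
  replace (INR T * (INR Jw * (5 / sqrt (INR P)))) with (INR (Jw * T) * (5 * s)) by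
    (rewrite mult_INR; unfold s, Rdiv; ring).
  assert (Hw1 : 0 < / (INR M1 * INR M2) <= 1).
  { split; [apply Rinv_0_lt_compat; nra|]. rewrite <- Rinv_1. apply Rinv_le_contravar; nra. }
  (* The losses are 1/2, 26 and 10 times N/sqrt P, and one more for each of the two [osc] averages;
     40 exceeds their sum. *)
  assert (D1 : INR (Jw * T) * / (INR M1 * INR M2) <= INR N * / (INR M1 * INR M2) + INR N * s / 2).
  { apply Rle_trans with ((INR N + INR T) * / (INR M1 * INR M2)); [apply Rmult_le_compat_r; lra|].
    assert (INR T * / (INR M1 * INR M2) <= INR T) by (rewrite <- (Rmult_1_r (INR T)) at 2; apply Rmult_le_compat_l; lra).
    assert (INR N / INR P <= INR N * s) by (apply Rmult_le_compat_l; lra). lra. }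
  assert (D2 : INR (Jw * T) * (13 * / INR P) <= 26 * (INR N * s)).
  { apply Rle_trans with (2 * INR N * (13 * s)); [|lra]. apply Rmult_le_compat; try lra. apply pos_INR. }
  assert (D3 : INR (Jw * T) * (5 * s) <= 10 * (INR N * s)).
  { apply Rle_trans with (2 * INR N * (5 * s)); [|lra]. apply Rmult_le_compat_r; lra. }
  assert (D4 : INR N / INR P <= INR N * s) by (apply Rmult_le_compat_l; lra).
  unfold Rdiv in *. fold s. lra.
Qed.

(** * Pairs of residues, coded as one class index, and their discrepancy on [N, 2N) *)

Definition digit_class (q1 q2 m1 m2 n : nat) : nat :=
  (digit_sum q1 n mod m1 * m2 + digit_sum q2 n mod m2)%nat.

Lemma pair_code_inj (m a b a' b' : nat) : (b < m)%nat -> (b' < m)%nat ->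
  (a * m + b = a' * m + b')%nat -> a = a' /\ b = b'.
Proof. intros. assert (a = a') by nia. subst. lia. Qed.

Lemma digit_class_lt (q1 q2 m1 m2 n : nat) : (1 <= m1)%nat -> (1 <= m2)%nat ->
  (digit_class q1 q2 m1 m2 n < m1 * m2)%nat.
Proof.
  intros H1 H2. unfold digit_class.
  pose proof (Nat.mod_upper_bound (digit_sum q1 n) m1 ltac:(lia)).
  pose proof (Nat.mod_upper_bound (digit_sum q2 n) m2 ltac:(lia)). nia.
Qed.

Lemma same_of_mod (q M n n' : nat) : (1 <= M)%nat ->
  (digit_sum q n mod M = digit_sum q n' mod M)%nat -> same q M n n' = true.
Proof.
  intros HM E. unfold same.
  rewrite (divides_b_shift _ 0 M (Z.of_nat (digit_sum q n / M) - Z.of_nat (digit_sum q n' / M))).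
  - unfold divides_b. rewrite Zmod_0_l. reflexivity.
  - lia.
  - pose proof (Nat.div_mod_eq (digit_sum q n) M). pose proof (Nat.div_mod_eq (digit_sum q n') M).
    nia.
Qed.

Lemma digit_class_same (q1 q2 m1 m2 n n' : nat) : (1 <= m1)%nat -> (1 <= m2)%nat ->
  digit_class q1 q2 m1 m2 n = digit_class q1 q2 m1 m2 n' ->
  same q1 m1 n n' && same q2 m2 n n' = true.
Proof.
  intros H1 H2 E. unfold digit_class in E. apply pair_code_inj in E;
    try (apply Nat.mod_upper_bound; lia).
  destruct E. apply andb_true_iff. split; apply same_of_mod; assumption.
Qed.

(** The outer use of [second_moment]: summed over classes, the product of two shifted indicators
    says that both shifts have the same class, and equal classes imply the event of
    [shifted_correlation]. The weight [chi] selects the class [l]. *)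
Lemma block_discrepancy (c : R) (q1 q2 M1 M2 j1 j2 N P J h0 l : nat) (eps1 eps2 : R) :
  1 < c < 2 ->
  (2 <= q1)%nat -> (2 <= q2)%nat -> (1 <= M1)%nat -> (1 <= M2)%nat ->
  Nat.gcd q1 q2 = 1%nat -> Nat.gcd M1 (q1 - 1) = 1%nat -> Nat.gcd M2 (q2 - 1) = 1%nat ->
  (0 < N)%nat -> (0 < P)%nat -> (0 < J)%nat -> (0 < h0)%nat -> 0 <= eps1 -> 0 <= eps2 ->
  let Q1 := (block q1 M1 ^ j1)%nat in let Q2 := (block q2 M2 ^ j2)%nat in
  (INR (block q1 M1) - INR M1 / INR (block q1 M1)) ^ j1 <= INR Q1 * eps1 ->
  (INR (block q2 M2) - INR M2 / INR (block q2 M2)) ^ j2 <= INR Q2 * eps2 ->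
  params_ok c N P J Q1 Q2 h0 eps1 eps2 -> (l < M1 * M2)%nat ->
  Rabs (rsum N (fun n => indic (Nat.eqb (digit_class q1 q2 M1 M2 (nfloor (npow c (N + n)))) l))
        - INR N / (INR M1 * INR M2))
  <= (1 + 7 * (INR M1 * INR M2)) * INR N / sqrt (sqrt (INR P)).
Proof.
  intros Hc Hq1 Hq2 HM1 HM2 Hq Hg1 Hg2 HN HP HJ Hh0 He1 He2 Q1 Q2 HE1 HE2 Hok Hl.
  set (w := (M1 * M2)%nat) in *. assert (Hw : (0 < w)%nat) by lia.
  assert (Hw' : INR w = INR M1 * INR M2) by apply mult_INR.
  rewrite <- Hw'.
  assert (Hw1 : 1 <= INR w) by (apply (le_INR 1); lia).
  assert (HP' : 1 <= INR P) by (apply (le_INR 1); lia).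
  assert (HN' : 1 <= INR N) by (apply (le_INR 1); lia).
  set (cl := fun n => digit_class q1 q2 M1 M2 (nfloor (npow c (N + n)))).
  assert (Hcl : forall n, (cl n < w)%nat) by (intros; apply digit_class_lt; assumption).
  set (F := fun n v => indic (Nat.eqb (cl n) v)).
  set (s := sqrt (INR P)).
  assert (Hs : 1 <= s) by (unfold s; rewrite <- sqrt_1; apply sqrt_le_1_alt; lra).
  assert (Hs2 : s * s = INR P) by (apply sqrt_sqrt; lra).
  set (Rem := fun j j' => 40 * INR N / s + INR N * indic (Nat.eqb j j')).
  assert (Hcorr : forall j k, (0 < k)%nat -> (j + k < P)%nat ->
    rsum N (fun n => rsum w (fun v => F (n + j)%nat v * F (n + (j + k))%nat v))
      <= INR N / INR w + 40 * INR N / s).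
  { intros j k Hk Hjk.
    assert (Hb := shifted_correlation c q1 q2 M1 M2 j1 j2 N P J h0 (N + j) k eps1 eps2 Hc Hq1 Hq2
      HM1 HM2 Hq Hg1 Hg2 HN HP HJ Hh0 Hk ltac:(lia) ltac:(lia) He1 He2 HE1 HE2 Hok).
    rewrite <- Hw' in Hb. fold s in Hb. eapply Rle_trans; [|exact Hb].
    apply rsum_le; intros n _.
    unfold F at 1. rewrite (rsum_single w (cl (n + j)%nat) (fun v => F (n + (j + k))%nat v)) by apply Hcl.
    apply indic_le. intros E. apply Nat.eqb_eq in E. unfold cl in E.
    apply digit_class_same; [assumption|assumption|].
    replace (N + j + n + k)%nat with (N + (n + (j + k)))%nat by lia.
    replace (N + j + n)%nat with (N + (n + j))%nat by lia. exact E. }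
  assert (HSM := second_moment N P w 1 F Rem (fun v => indic (Nat.eqb l v)) HN HP Hw ltac:(lra)
    ltac:(intros; apply indic_bounds) ltac:(intros; apply rsum_indic_single, Hcl)
    ltac:(intros; apply indic_bounds)).
  assert (Hs40 : 0 <= 40 * INR N / s).
  { apply Rmult_le_pos; [lra|left; apply Rinv_0_lt_compat; lra]. }
  assert (HNw : 0 <= INR N / INR w) by (apply Rmult_le_pos; [lra|left; apply Rinv_0_lt_compat; lra]).
  assert (HSM' := HSM ltac:(
    intros j j' Hj Hj'; unfold Rem; rewrite pow1, Rmult_1_r;
    destruct (Nat.eqb_spec j j') as [->|Hne]; simpl indic;
    [ apply Rle_trans with (INR N * 1);
      [ apply rsum_le_const; intros n _; unfold F at 1; rewrite (rsum_single w (cl (n + j')%nat) (fun v => F (n + j')%nat v)) by apply Hcl; apply indic_bounds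
      | lra]
    | rewrite Rmult_0_r, Rplus_0_r;
      destruct (Nat.lt_ge_cases j j');
      [ replace j' with (j + (j' - j))%nat by lia; apply Hcorr; lia
      | rewrite (rsum_ext N _ (fun n => rsum w (fun v => F (n + j')%nat v * F (n + j)%nat v)))
          by (intros n _; apply rsum_ext; intros; ring);
        replace j with (j' + (j - j'))%nat by lia; apply Hcorr; lia ] ])).
  clear HSM.
  rewrite (rsum_ext N _ (fun n => indic (Nat.eqb (cl n) l))) in HSM'.
  2:{ intros n _. rewrite (rsum_single w l (fun v => F n v)) by exact Hl. reflexivity. }
  rewrite rsum_indic_single in HSM' by exact Hl.
  replace (INR N * 1 / INR w * 1) with (INR N / INR w) in HSM' by (field; lra).
  eapply Rle_trans; [exact HSM'|].
  (* The diagonal adds N P, which is at most N P^2 / s, hence 41; the 7 below is its root rounded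
     up. *)
  assert (HSR : rsum P (fun j => rsum P (Rem j)) <= 41 * INR N * INR P ^ 2 / s).
  { apply Rle_trans with (INR P * (INR P * (40 * INR N / s) + INR N * 1)).
    - apply rsum_le_const; intros j Hj. unfold Rem. rewrite rsum_plus, rsum_const, rsum_scal.
      rewrite rsum_indic_single by exact Hj. lra.
    - apply Rmult_le_reg_r with s; [lra|]. field_simplify; [|lra|lra]. rewrite <- Hs2.
      assert (0 <= INR N * s ^ 2) by (apply Rmult_le_pos; nra).
      assert (INR N * s ^ 2 * s <= INR N * s ^ 2 * (s * s)) by (apply Rmult_le_compat_l; nra). nra. }
  set (r := sqrt s) in *.
  assert (Hr : 1 <= r) by (unfold r; rewrite <- sqrt_1; apply sqrt_le_1_alt; lra).
  assert (Hr2 : r * r = s) by (apply sqrt_sqrt; lra).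
  assert (Hroot : sqrt (INR N * INR w * rsum P (fun j => rsum P (Rem j))) <= 7 * INR w * INR N * INR P / r).
  { rewrite <- (sqrt_Rsqr (7 * INR w * INR N * INR P / r)).
    2:{ apply Rmult_le_pos; [repeat apply Rmult_le_pos; lra|left; apply Rinv_0_lt_compat; lra]. }
    apply sqrt_le_1_alt. unfold Rsqr.
    apply Rle_trans with (INR N * INR w * (41 * INR N * INR P ^ 2 / s)).
    - apply Rmult_le_compat_l; [nra|exact HSR].
    - rewrite <- Hr2.
      replace (7 * INR w * INR N * INR P / r * (7 * INR w * INR N * INR P / r)) with
        ((INR N ^ 2 * INR P ^ 2 / (r * r)) * (49 * (INR w * INR w))) by (field; lra).
      replace (INR N * INR w * (41 * INR N * INR P ^ 2 / (r * r))) with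
        ((INR N ^ 2 * INR P ^ 2 / (r * r)) * (41 * INR w)) by (field; lra).
      apply Rmult_le_compat_l; [|nra].
      apply Rmult_le_pos; [apply Rmult_le_pos; apply pow_le; lra|left; apply Rinv_0_lt_compat; nra]. }
  apply Rle_trans with (1 * INR P + / INR P * (7 * INR w * INR N * INR P / r)).
  { apply Rplus_le_compat_l. apply Rmult_le_compat_l; [left; apply Rinv_0_lt_compat; lra|exact Hroot]. }
  assert (HPN : INR P <= INR N / r).
  { destruct Hok as [_ [p2 _]].
    assert (Hp : (P * P <= N)%nat) by nia. apply le_INR in Hp. rewrite mult_INR in Hp.
    apply Rmult_le_reg_r with r; [lra|]. field_simplify; [|lra].
    assert (r <= INR P) by (rewrite <- Hs2, <- Hr2; nra). nra. }
  replace (/ INR P * (7 * INR w * INR N * INR P / r)) with (7 * INR w * (INR N / r)) by (field; lra).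
  replace ((1 + 7 * INR w) * INR N / r) with (INR N / r + 7 * INR w * (INR N / r)) by (field; lra).
  lra.
Qed.

(** * Choice of parameters and conclusion *)

Lemma Rpower_eventually_large (C a : R) : 0 < a ->
  exists N0, forall N, (N0 <= N)%nat -> (0 < N)%nat /\ C <= Rpower (INR N) a.
Proof.
  intros Ha. set (D := Rmax 1 C). assert (HD : 1 <= D) by apply Rmax_l.
  assert (HC : C <= D) by apply Rmax_r.
  pose proof (Rpower_pos D (/ a)) as Hp.
  exists (nfloor (Rpower D (/ a)) + 1)%nat. intros N HN. split; [lia|].
  destruct (nfloor_spec (Rpower D (/ a)) ltac:(lra)) as [_ H].
  apply le_INR in HN. rewrite plus_INR in HN. simpl (INR 1) in HN.
  apply Rle_trans with D; [exact HC|].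
  apply Rle_trans with (Rpower (Rpower D (/ a)) a).
  - rewrite Rpower_mult, Rinv_l, Rpower_1 by lra. lra.
  - apply Rle_Rpower_l; lra.
Qed.

Lemma pow_bracket (W : nat) (Y : R) : (2 <= W)%nat -> 1 <= Y ->
  exists j, Y <= INR (W ^ j) <= INR W * Y.
Proof.
  intros HW HY. assert (HW' : 2 <= INR W) by (apply (le_INR 2); lia).
  assert (Hex : exists j, Y <= INR (W ^ j)).
  { exists (nfloor Y + 1)%nat. destruct (nfloor_spec Y ltac:(lra)) as [_ H].
    apply Rle_trans with (INR (nfloor Y + 1)); [rewrite plus_INR; simpl (INR 1); lra|].
    apply le_INR. apply Nat.lt_le_incl, Nat.pow_gt_lin_r. lia. }
  destruct Hex as [n Hn]. revert Hn. induction n as [|n IH]; intros Hn.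
  - exists 0%nat. simpl in *. split; nra.
  - destruct (Rle_dec Y (INR (W ^ n))) as [H|H]; [exact (IH H)|].
    exists (S n). split; [exact Hn|]. rewrite Nat.pow_succ_r', mult_INR.
    apply Rmult_le_compat_l; lra.
Qed.

(** With [W = block q M], the mean factor per block is rho = 1 - M/W^2, and [tau] solves rho =
    W^(-tau); the mean over W^j values thus saves a fixed power of W^j. *)
Lemma osc_decay (q M : nat) : (2 <= q)%nat -> (1 <= M)%nat ->
  exists tau, 0 < tau /\ forall j,
  (INR (block q M) - INR M / INR (block q M)) ^ j =
  INR (block q M ^ j) * Rpower (INR (block q M ^ j)) (- tau).
Proof.
  intros Hq HM. destruct (block_bounds q M Hq) as [H1 H2].
  set (W := block q M) in *.
  assert (HW : 2 < INR W) by (apply (lt_INR 2); lia).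
  assert (HM' : 1 <= INR M) by (apply (le_INR 1); lia).
  assert (HMW : INR M < INR W) by (apply lt_INR; lia).
  set (rho := 1 - INR M / (INR W * INR W)).
  assert (Hrho : 0 < rho < 1).
  { assert (0 < INR M / (INR W * INR W) < 1).
    { split; [apply Rdiv_lt_0_compat; nra|].
      apply Rmult_lt_reg_r with (INR W * INR W); [nra|]. unfold Rdiv.
      rewrite Rmult_assoc, Rinv_l by nra. nra. }
    unfold rho. lra. }
  assert (HlW : 0 < ln (INR W)) by (rewrite <- ln_1; apply ln_increasing; lra).
  assert (Hlr : ln rho < 0) by (rewrite <- ln_1; apply ln_increasing; lra).
  exists (- ln rho / ln (INR W)). split.
  - apply Rdiv_lt_0_compat; lra.
  - intros j. rewrite pow_INR.
    replace (INR W - INR M / INR W) with (INR W * rho) by (unfold rho; field; lra).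
    rewrite Rpow_mult_distr. f_equal.
    rewrite <- (Rpower_pow j (INR W)) by lra. rewrite Rpower_mult.
    rewrite <- (Rpower_pow j rho) by lra. unfold Rpower. f_equal. field. lra.
Qed.

(** Since [Qi] is at least N^(c-1), the factor Qi^(-tau) saves N^((c-1)tau), while [Qi / curv] is
    O(P^2 N). With the 1/P on the right, a loss of P^3 has to be covered by the saving. *)
Lemma decay_condition (c tau C : R) (N P Qi : nat) :
  1 < c < 2 -> (0 < N)%nat -> (1 <= P)%nat -> 0 < tau -> 0 <= C ->
  INR Qi <= C * INR P ^ 2 * Rpower (INR N) (c - 1) ->
  Rpower (INR N) (c - 1) <= INR Qi ->
  INR P ^ 3 * (10 * (1 + C / (c * (c - 1)))) <= Rpower (INR N) ((c - 1) * tau) ->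
  10 * Rpower (INR Qi) (- tau) * (INR N + INR Qi / curv c (INR N)) <= INR N / INR P.
Proof.
  intros Hc HN HP Htau HC Hup Hlow Hlarge.
  assert (HN' : 0 < INR N) by (apply lt_0_INR; lia).
  assert (HP' : 1 <= INR P) by (apply (le_INR 1); lia).
  pose proof (Rpower_pos (INR N) (c - 1)) as Hpc.
  set (V := Rpower (INR N) ((c - 1) * tau)) in *.
  assert (HV : 0 < V) by apply Rpower_pos.
  assert (H1 : Rpower (INR Qi) (- tau) <= / V).
  { rewrite Rpower_Ropp. apply Rinv_le_contravar; [exact HV|]. unfold V.
    rewrite <- Rpower_mult. apply Rle_Rpower_l; lra. }
  assert (Hcc : 0 < c * (c - 1)) by nra.
  assert (H2 : INR Qi / curv c (INR N) <= C / (c * (c - 1)) * INR P ^ 2 * INR N).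
  { pose proof (curv_pos c (INR N) ltac:(lra)) as Hk.
    apply Rmult_le_reg_r with (curv c (INR N)); [exact Hk|].
    replace (INR Qi / curv c (INR N) * curv c (INR N)) with (INR Qi) by (field; lra).
    eapply Rle_trans; [exact Hup|]. unfold curv. apply Req_le.
    replace (c - 1) with (1 + (c - 2)) at 1 by ring.
    rewrite Rpower_plus, Rpower_1 by lra. field. lra. }
  set (D := C / (c * (c - 1))) in *.
  assert (HD : 0 <= D) by (apply Rmult_le_pos; [lra|left; apply Rinv_0_lt_compat; lra]).
  assert (HQ0 : 0 <= INR Qi / curv c (INR N)).
  { apply Rmult_le_pos; [apply pos_INR|left; apply Rinv_0_lt_compat, curv_pos; lra]. }
  apply Rle_trans with (10 * / V * (INR N * (INR P ^ 2 * (1 + D)))).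
  - apply Rmult_le_compat; [|lra|lra|].
    + pose proof (Rpower_pos (INR Qi) (- tau)). lra.
    + assert (1 <= INR P ^ 2) by nra. nra.
  - apply Rmult_le_reg_r with (V * INR P); [nra|].
    replace (10 * / V * (INR N * (INR P ^ 2 * (1 + D))) * (V * INR P)) with
      (INR N * (INR P ^ 3 * (10 * (1 + D)))) by (field; lra).
    replace (INR N / INR P * (V * INR P)) with (INR N * V) by (field; lra).
    apply Rmult_le_compat_l; lra.
Qed.

Lemma nfloor_half (x : R) : 1 <= x -> x / 2 <= INR (nfloor x) <= x /\ (1 <= nfloor x)%nat.
Proof.
  intros Hx. destruct (nfloor_spec x ltac:(lra)) as [H1 H2].
  pose proof (nfloor_ge_nat x 1 ltac:(simpl; lra)) as H.
  split; [|exact H]. apply (le_INR 1) in H. simpl (INR 1) in H. lra.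
Qed.

(* The binding constraint is [2 * h0 * (Q * (P * P)) <= J]: with [J] about [1 / (kap P^3)],
   [h0] about [Q P^3] and [Q] about [P^4 N^(2c-2)] it asks that [P^16 N^(5c-6)] be small. *)
Lemma choose_params (c : R) (q1 q2 M1 M2 : nat) : 1 < c < 18 / 17 ->
  (2 <= q1)%nat -> (2 <= q2)%nat -> (1 <= M1)%nat -> (1 <= M2)%nat ->
  exists delta, 0 < delta <= 1 / 32 /\ exists N0, forall N, (N0 <= N)%nat ->
  exists P J h0 j1 j2 eps1 eps2,
    (0 < N)%nat /\ (0 < P)%nat /\ (0 < J)%nat /\ (0 < h0)%nat /\ 0 <= eps1 /\ 0 <= eps2 /\
    Rpower (INR N) delta / 2 <= INR P /\
    (INR (block q1 M1) - INR M1 / INR (block q1 M1)) ^ j1 <= INR (block q1 M1 ^ j1) * eps1 /\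
    (INR (block q2 M2) - INR M2 / INR (block q2 M2)) ^ j2 <= INR (block q2 M2 ^ j2) * eps2 /\
    params_ok c N P J (block q1 M1 ^ j1) (block q2 M2 ^ j2) h0 eps1 eps2.
Proof.
  intros Hc Hq1 Hq2 HM1 HM2.
  destruct (osc_decay q1 M1 Hq1 HM1) as [tau1 [Ht1 E1]].
  destruct (osc_decay q2 M2 Hq2 HM2) as [tau2 [Ht2 E2]].
  destruct (block_bounds q1 M1 Hq1) as [_ HB1]. destruct (block_bounds q2 M2 Hq2) as [_ HB2].
  set (W1 := block q1 M1) in *. set (W2 := block q2 M2) in *.
  assert (HW1 : 1 <= INR W1) by (apply (le_INR 1); lia).
  assert (HW2 : 1 <= INR W2) by (apply (le_INR 1); lia).
  (* Half of the saved exponent (c-1)tau, that is 3a, pays for P^3, and the other half for the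
     constant. *)
  set (a1 := (c - 1) * tau1 / 6). set (a2 := (c - 1) * tau2 / 6).
  assert (Ha1 : 0 < a1) by (unfold a1; nra). assert (Ha2 : 0 < a2) by (unfold a2; nra).
  set (delta := Rmin (1 / 32) (Rmin a1 a2)).
  assert (Hd : 0 < delta <= 1 / 32 /\ delta <= a1 /\ delta <= a2).
  { unfold delta. pose proof (Rmin_l (1 / 32) (Rmin a1 a2)). pose proof (Rmin_r (1 / 32) (Rmin a1 a2)).
    pose proof (Rmin_l a1 a2). pose proof (Rmin_r a1 a2).
    repeat split; try lra. repeat apply Rmin_glb_lt; lra. }
  destruct Hd as [Hd [Hda1 Hda2]].
  exists delta. split; [exact Hd|].
  destruct (Rpower_eventually_large (10 * (1 + 9 * INR W1 / (c * (c - 1)))) (3 * a1) ltac:(lra)) as [n1 L1].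
  destruct (Rpower_eventually_large (10 * (1 + 9 * INR W2 / (c * (c - 1)))) (3 * a2) ltac:(lra)) as [n2 L2].
  destruct (Rpower_eventually_large (2 / (c * (c - 1))) (c - 1) ltac:(lra)) as [n3 L3].
  destruct (Rpower_eventually_large (64 * 81 ^ 2 * (INR W1 * INR W2) ^ 2) (1 / 5) ltac:(lra)) as [n4 L4].
  exists (n1 + n2 + n3 + n4)%nat. intros N HN.
  destruct (L1 N ltac:(lia)) as [HN0 L1']. destruct (L2 N ltac:(lia)) as [_ L2'].
  destruct (L3 N ltac:(lia)) as [_ L3']. destruct (L4 N ltac:(lia)) as [_ L4'].
  clear L1 L2 L3 L4.
  assert (HN1 : 1 <= INR N) by (apply (le_INR 1); lia).
  assert (Hpow1 : forall s, 0 <= s -> 1 <= Rpower (INR N) s).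
  { intros s Hs. rewrite <- (Rpower_O (INR N)) at 1 by lra. apply Rle_Rpower; lra. }
  set (P := nfloor (Rpower (INR N) delta)).
  destruct (nfloor_half (Rpower (INR N) delta) (Hpow1 delta ltac:(lra))) as [[HP1 HP2] HP3].
  fold P in HP1, HP2, HP3.
  assert (HP' : 1 <= INR P) by (apply (le_INR 1); lia).
  assert (HPpow : forall n, INR P ^ n <= Rpower (INR N) (INR n * delta)).
  { intros n. rewrite Rmult_comm, <- Rpower_mult, Rpower_pow by apply Rpower_pos.
    apply pow_incr. lra. }
  (* The smallest size that [params_ok] allows for [Q1] and [Q2]. *)
  set (Y := 9 * INR P ^ 2 * Rpower (INR N) (c - 1)).
  assert (Hc1 : 1 <= Rpower (INR N) (c - 1)) by (apply Hpow1; lra).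
  assert (HPP : 1 <= INR P ^ 2) by nra.
  assert (HYc : Rpower (INR N) (c - 1) <= Y) by (unfold Y; nra).
  destruct (pow_bracket W1 Y ltac:(lia) ltac:(lra)) as [j1 [B1 B1']].
  destruct (pow_bracket W2 Y ltac:(lia) ltac:(lra)) as [j2 [B2 B2']].
  set (Q1 := (W1 ^ j1)%nat) in *. set (Q2 := (W2 ^ j2)%nat) in *.
  set (kap := curv c (INR N)). assert (Hk : 0 < kap) by (apply curv_pos; lra).
  assert (HQ1 : 1 <= INR Q1) by lra. assert (HQ2 : 1 <= INR Q2) by lra.
  (* For c < 18/17 the exponent 5c - 6 is below -12/17. The bound on [delta] gives P^16 <= N^(1/2)
     and the constants are at most N^(1/5); the sum 1/2 + 1/5 stays below 12/17. The 81^2 is 9^4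
     from Y^4. *)
  assert (Hkey : 64 * (INR Q1 * INR Q2) ^ 2 * INR P ^ 8 * kap <= 1).
  { assert (K1 : (INR Q1 * INR Q2) ^ 2 <= (INR W1 * INR W2 * (Y * Y)) ^ 2).
    { apply pow_incr. split; [apply Rmult_le_pos; lra|].
      replace (INR W1 * INR W2 * (Y * Y)) with ((INR W1 * Y) * (INR W2 * Y)) by ring.
      apply Rmult_le_compat; lra. }
    assert (K2 : kap <= Rpower (INR N) (c - 2)).
    { unfold kap, curv. pose proof (Rpower_pos (INR N) (c - 2)).
      assert (Hcc : c * (c - 1) <= 2 * (1 / 17)) by (apply Rmult_le_compat; lra).
      rewrite <- (Rmult_1_l (Rpower _ _)) at 2. apply Rmult_le_compat_r; lra. }
    assert (HP8 : 0 <= INR P ^ 8) by (apply pow_le; lra).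
    apply Rle_trans with (64 * (INR W1 * INR W2 * (Y * Y)) ^ 2 * INR P ^ 8 * Rpower (INR N) (c - 2)).
    { apply Rmult_le_compat; [|lra| |exact K2].
      - apply Rmult_le_pos; [|exact HP8]. apply Rmult_le_pos; [lra|apply pow2_ge_0].
      - apply Rmult_le_compat_r; [exact HP8|]. lra. }
    unfold Y.
    replace (64 * (INR W1 * INR W2 * (9 * INR P ^ 2 * Rpower (INR N) (c - 1) * (9 * INR P ^ 2 * Rpower (INR N) (c - 1)))) ^ 2 * INR P ^ 8 * Rpower (INR N) (c - 2))
      with ((64 * 81 ^ 2 * (INR W1 * INR W2) ^ 2) * (INR P ^ 16 * (Rpower (INR N) (c - 1) ^ 4 * Rpower (INR N) (c - 2)))) by ring.
    rewrite <- (Rpower_pow 4 (Rpower (INR N) (c - 1))) by apply Rpower_pos.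
    rewrite Rpower_mult, <- Rpower_plus.
    apply Rle_trans with (Rpower (INR N) (1 / 5) * (Rpower (INR N) (INR 16 * delta) * Rpower (INR N) ((c - 1) * INR 4 + (c - 2)))).
    { pose proof (Rpower_pos (INR N) ((c - 1) * INR 4 + (c - 2))).
      assert (0 <= INR P ^ 16) by (apply pow_le; lra).
      apply Rmult_le_compat; [|apply Rmult_le_pos; lra|exact L4'|].
      - apply Rmult_le_pos; [lra|apply pow2_ge_0].
      - apply Rmult_le_compat_r; [lra|apply HPpow]. }
    rewrite <- !Rpower_plus.
    apply Rle_trans with (Rpower (INR N) 0); [|rewrite Rpower_O; lra].
    apply Rle_Rpower; [lra|]. replace (INR 16) with 16 by (simpl; ring).
    replace (INR 4) with 4 by (simpl; ring). lra. }
  (* The largest real value of [J] that the first condition admits. *)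
  set (u := / (kap * INR P ^ 3)).
  assert (HkP : 0 < kap * INR P ^ 3) by (apply Rmult_lt_0_compat; [lra|apply pow_lt; lra]).
  assert (Hu : u * (kap * INR P ^ 3) = 1) by (unfold u; field; lra).
  assert (Hu0 : 0 < u) by (apply Rinv_0_lt_compat; exact HkP).
  set (QQ := INR Q1 * INR Q2) in *. assert (HQQ : 1 <= QQ) by (unfold QQ; nra).
  assert (HP5 : 1 <= INR P ^ 5) by (apply pow_R1_Rle; lra).
  assert (Hu64 : 64 * QQ ^ 2 * INR P ^ 5 <= u).
  { apply Rmult_le_reg_r with (kap * INR P ^ 3); [exact HkP|]. rewrite Hu.
    replace (64 * QQ ^ 2 * INR P ^ 5 * (kap * INR P ^ 3)) with (64 * QQ ^ 2 * INR P ^ 8 * kap) by ring.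
    exact Hkey. }
  assert (HQQ2 : 1 <= QQ ^ 2) by nra.
  assert (Hu1 : 1 <= u) by nra.
  set (J := nfloor u). destruct (nfloor_half u Hu1) as [[HJ1 HJ2] HJ3]. fold J in HJ1, HJ2, HJ3.
  (* Rounding gives only [J >= u / 2], and with 16 the winding condition holds with its constant 8
     exactly. *)
  set (h0 := (16 * (Q1 * Q2) * P ^ 3)%nat).
  assert (Hh0 : INR h0 = 16 * QQ * INR P ^ 3).
  { unfold h0, QQ. rewrite !mult_INR, pow_INR. replace (INR 16) with 16 by (simpl; ring). ring. }
  assert (HP3' : 1 <= INR P ^ 3) by (apply pow_R1_Rle; lra).
  assert (HcN : 2 <= kap * INR N).
  { unfold kap, curv. rewrite Rmult_assoc. rewrite <- (Rpower_1 (INR N)) at 2 by lra.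
    rewrite <- Rpower_plus. replace (c - 2 + 1) with (c - 1) by ring.
    assert (0 < c * (c - 1)) by nra.
    apply Rmult_le_reg_l with (/ (c * (c - 1))); [apply Rinv_0_lt_compat; lra|].
    field_simplify; [|lra|lra]. replace (c ^ 2 - c) with (c * (c - 1)) by ring. exact L3'. }
  exists P, J, h0, j1, j2, (Rpower (INR Q1) (- tau1)), (Rpower (INR Q2) (- tau2)).
  split; [exact HN0|]. split; [lia|]. split; [lia|].
  split.
  { apply INR_lt. rewrite Hh0. simpl (INR 0). apply Rmult_lt_0_compat; lra. }
  split; [left; apply Rpower_pos|]. split; [left; apply Rpower_pos|].
  split; [lra|]. split; [right; apply E1|]. split; [right; apply E2|].
  assert (HYW : forall W, W * Y = 9 * W * INR P ^ 2 * Rpower (INR N) (c - 1)) by (intros; unfold Y; ring).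
  assert (HP6 : forall tau a, a = (c - 1) * tau / 6 -> delta <= a -> forall D, 0 <= D ->
    D <= Rpower (INR N) (3 * a) -> INR P ^ 3 * D <= Rpower (INR N) ((c - 1) * tau)).
  { intros tau a Ha Hda D HD0 HD.
    replace ((c - 1) * tau) with (3 * a + 3 * a) by (rewrite Ha; field). rewrite Rpower_plus.
    apply Rmult_le_compat; [lra|exact HD0| |exact HD].
    eapply Rle_trans; [apply HPpow|]. apply Rle_Rpower; [lra|].
    replace (INR 3) with 3 by (simpl; ring). lra. }
  assert (HD : forall W, 1 <= W -> 0 <= 10 * (1 + 9 * W / (c * (c - 1)))).
  { intros W HW. assert (0 <= 9 * W / (c * (c - 1))).
    { apply Rmult_le_pos; [lra|left; apply Rinv_0_lt_compat; nra]. } lra. }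
  unfold params_ok. cbv zeta. fold Q1 Q2 kap. rewrite (mult_INR Q1 Q2). fold QQ.
  repeat split.
  - rewrite <- Hu. apply Rle_trans with (kap * INR P ^ 3 * u); [|lra]. apply Rmult_le_compat_l; lra.
  - apply INR_le. rewrite !mult_INR. replace (INR 2) with 2 by (simpl; ring).
    apply Rmult_le_reg_r with kap; [lra|].
    apply Rle_trans with 2; [|lra].
    apply Rle_trans with (2 * (INR P ^ 2 * kap * u)).
    + replace (2 * (INR P * INR J) * INR P * kap) with (2 * (INR P ^ 2 * kap * INR J)) by ring.
      apply Rmult_le_compat_l; [lra|]. apply Rmult_le_compat_l; [|lra]. apply Rmult_le_pos; lra.
    + assert (INR P ^ 2 * (kap * u) <= INR P ^ 3 * (kap * u)).
      { apply Rmult_le_compat_r; [apply Rmult_le_pos; lra|]. simpl. nra. }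
      lra.
  - rewrite Hh0. apply Rle_trans with (u / 2 * kap * (16 * QQ * INR P ^ 3)).
    + replace (u / 2 * kap * (16 * QQ * INR P ^ 3)) with (8 * QQ * (u * (kap * INR P ^ 3))) by field.
      rewrite Hu. lra.
    + apply Rmult_le_compat_r; [|apply Rmult_le_compat_r; lra]. apply Rmult_le_pos; lra.
  - apply INR_le. rewrite !mult_INR, Hh0. fold QQ. replace (INR 2) with 2 by (simpl; ring).
    replace (2 * (16 * QQ * INR P ^ 3) * (QQ * (INR P * INR P))) with (64 * QQ ^ 2 * INR P ^ 5 / 2) by field.
    lra.
  - exact B1.
  - exact B2.
  - apply decay_condition with (C := 9 * INR W1); try assumption; try lra.
    + rewrite <- HYW. exact B1'.
    + apply HP6 with a1; auto.
  - apply decay_condition with (C := 9 * INR W2); try assumption; try lra.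
    + rewrite <- HYW. exact B2'.
    + apply HP6 with a2; auto.
Qed.

(** * Power saving on dyadic ranges and their summation *)

Lemma sqrt_Rpower (x a : R) : 0 < x -> sqrt (Rpower x a) = Rpower x (a / 2).
Proof.
  intros Hx. rewrite <- Rpower_sqrt by apply Rpower_pos. rewrite Rpower_mult. reflexivity.
Qed.

Lemma dyadic_discrepancy (c : R) (q1 q2 M1 M2 l : nat) : 1 < c < 18 / 17 ->
  (2 <= q1)%nat -> (2 <= q2)%nat -> (1 <= M1)%nat -> (1 <= M2)%nat ->
  Nat.gcd q1 q2 = 1%nat -> Nat.gcd M1 (q1 - 1) = 1%nat -> Nat.gcd M2 (q2 - 1) = 1%nat ->
  (l < M1 * M2)%nat ->
  exists eps C, 0 < eps <= 1 / 2 /\ 0 <= C /\ forall N, (0 < N)%nat ->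
  Rabs (rsum N (fun n => indic (Nat.eqb (digit_class q1 q2 M1 M2 (nfloor (npow c (N + n)))) l))
        - INR N / (INR M1 * INR M2)) <= C * Rpower (INR N) (1 - eps).
Proof.
  intros Hc Hq1 Hq2 HM1 HM2 Hq Hg1 Hg2 Hl.
  destruct (choose_params c q1 q2 M1 M2 Hc Hq1 Hq2 HM1 HM2) as [delta [Hd [N0 Hpar]]].
  assert (HM1' : 1 <= INR M1) by (apply (le_INR 1); lia).
  assert (HM2' : 1 <= INR M2) by (apply (le_INR 1); lia).
  set (w := INR M1 * INR M2). assert (Hw : 1 <= w) by (unfold w; nra).
  (* The relative error is P^(-1/4) with P at least N^delta / 2; the summand [INR N0] absorbs the
     trivial bound for small [N]. *)
  exists (delta / 4), (2 * (1 + 7 * w) + INR N0).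
  split; [lra|]. split; [pose proof (pos_INR N0); lra|].
  intros N HN. assert (HN1 : 1 <= INR N) by (apply (le_INR 1); lia).
  destruct (Nat.le_gt_cases N0 N) as [HNN|HNN].
  - destruct (Hpar N HNN) as (P & J & h0 & j1 & j2 & e1 & e2 & _ & HP & HJ & Hh0 & He1 & He2 & HPd & HE1 & HE2 & Hok).
    eapply Rle_trans; [apply (block_discrepancy c q1 q2 M1 M2 j1 j2 N P J h0 l e1 e2); assumption || lra|].
    fold w.
    assert (Hs : Rpower (INR N) (delta / 4) / 2 <= sqrt (sqrt (INR P))).
    { apply Rle_trans with (sqrt (sqrt (Rpower (INR N) delta / 2))).
      2:{ do 2 apply sqrt_le_1_alt. exact HPd. }
      replace (delta / 4) with (delta / 2 / 2) by field. rewrite <- !sqrt_Rpower by lra.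
      set (x := Rpower (INR N) delta). assert (Hx : 0 < x) by apply Rpower_pos.
      assert (S1 : sqrt x / 2 <= sqrt (x / 2)).
      { rewrite <- (sqrt_Rsqr (sqrt x / 2)) by (pose proof (sqrt_pos x); lra).
        apply sqrt_le_1_alt. unfold Rsqr.
        replace (sqrt x / 2 * (sqrt x / 2)) with (sqrt x * sqrt x / 4) by field.
        rewrite sqrt_sqrt by lra. lra. }
      assert (Hsx : 0 < sqrt x) by (apply sqrt_lt_R0; exact Hx).
      apply Rle_trans with (sqrt (sqrt x / 2)); [|apply sqrt_le_1_alt; exact S1].
      rewrite <- (sqrt_Rsqr (sqrt (sqrt x) / 2)) by (pose proof (sqrt_pos (sqrt x)); lra).
      apply sqrt_le_1_alt. unfold Rsqr.
      replace (sqrt (sqrt x) / 2 * (sqrt (sqrt x) / 2)) with (sqrt (sqrt x) * sqrt (sqrt x) / 4) by field.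
      rewrite sqrt_sqrt by lra. lra. }
    set (v := Rpower (INR N) (delta / 4)) in *. assert (Hv : 0 < v) by apply Rpower_pos.
    replace (Rpower (INR N) (1 - delta / 4)) with (INR N / v).
    2:{ unfold v, Rdiv, Rminus. rewrite <- Rpower_Ropp, Rpower_plus, Rpower_1 by lra. reflexivity. }
    apply Rle_trans with ((1 + 7 * w) * INR N / (v / 2)).
    + unfold Rdiv at 1 2. apply Rmult_le_compat_l; [nra|]. apply Rinv_le_contravar; lra.
    + replace ((1 + 7 * w) * INR N / (v / 2)) with (2 * (1 + 7 * w) * (INR N / v)) by (field; lra).
      apply Rmult_le_compat_r; [|pose proof (pos_INR N0); lra].
      apply Rmult_le_pos; [lra|left; apply Rinv_0_lt_compat; lra].
  - set (s := rsum N _).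
    assert (Hs : 0 <= s <= INR N).
    { split; [apply rsum_nonneg; intros; apply indic_bounds|].
      rewrite <- (Rmult_1_r (INR N)). apply rsum_le_const; intros; apply indic_bounds. }
    assert (Hq' : 0 <= INR N / w <= INR N).
    { split; [apply Rmult_le_pos; [lra|left; apply Rinv_0_lt_compat; lra]|].
      apply Rmult_le_reg_r with w; [lra|]. field_simplify; nra. }
    assert (Hlt : INR N <= INR N0) by (apply le_INR; lia).
    assert (H1 : 1 <= Rpower (INR N) (1 - delta / 4)).
    { rewrite <- (Rpower_O (INR N)) at 1 by lra. apply Rle_Rpower; lra. }
    apply Rle_trans with (INR N0).
    + apply Rabs_le. fold w. lra.
    + assert (0 <= INR N0) by lra. nra.
Qed.

(** Halving [Y] leaves the lower half, a dyadic block and at most one odd term. As 1 - eps >= 1/2,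
    the power shrinks by at least sqrt 2 > 7/5, and (3(C+1) + C + 1) * 5/7 < 3(C+1) closes the
    induction. *)
Lemma dyadic_sum (f : nat -> R) (eps C : R) : 0 < eps <= 1 / 2 -> 0 <= C ->
  (forall n, Rabs (f n) <= 1) ->
  (forall N, (0 < N)%nat -> Rabs (rsum N (fun n => f (N + n)%nat)) <= C * Rpower (INR N) (1 - eps)) ->
  forall Y, (0 < Y)%nat -> Rabs (rsum Y f) <= 3 * (C + 1) * Rpower (INR Y) (1 - eps).
Proof.
  intros He HC Hf Hblock Y. induction Y as [Y IH] using lt_wf_ind. intros HY.
  assert (Hge1 : forall n, (0 < n)%nat -> 1 <= Rpower (INR n) (1 - eps)).
  { intros n Hn. assert (1 <= INR n) by (apply (le_INR 1); lia).
    rewrite <- (Rpower_O (INR n)) at 1 by lra. apply Rle_Rpower; lra. }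
  destruct (Nat.eq_dec Y 1) as [->|HY1].
  - simpl rsum. rewrite Rplus_0_l. specialize (Hf 0%nat). specialize (Hge1 1%nat ltac:(lia)). nra.
  - set (N := (Y / 2)%nat). pose proof (Nat.div_mod_eq Y 2) as E.
    pose proof (Nat.mod_upper_bound Y 2 ltac:(lia)) as Hr. fold N in E.
    assert (HN : (0 < N < Y)%nat) by lia.
    specialize (IH N ltac:(lia) ltac:(lia)). specialize (Hblock N ltac:(lia)).
    set (t := (Y mod 2)%nat) in *.
    replace Y with (N + N + t)%nat at 1 by lia. rewrite !rsum_app.
    assert (Ht : Rabs (rsum t (fun i => f (N + N + i)%nat)) <= 1).
    { destruct t as [|[|t]]; [simpl; rewrite Rabs_R0; lra| |lia].
      simpl rsum. rewrite Rplus_0_l. apply Hf. }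
    assert (HNN : (7 / 5) * Rpower (INR N) (1 - eps) <= Rpower (INR Y) (1 - eps)).
    { apply Rle_trans with (Rpower (2 * INR N) (1 - eps)).
      - assert (0 < INR N) by (apply lt_0_INR; lia).
        rewrite <- Rpower_mult_distr by lra.
        apply Rmult_le_compat_r; [left; apply Rpower_pos|].
        apply Rle_trans with (Rpower 2 (/ 2)); [|apply Rle_Rpower; lra].
        rewrite Rpower_sqrt by lra. rewrite <- (sqrt_Rsqr (7 / 5)) by lra.
        apply sqrt_le_1_alt. unfold Rsqr. lra.
      - apply Rle_Rpower_l; [lra|]. assert (0 < INR N) by (apply lt_0_INR; lia).
        split; [lra|]. replace 2 with (INR 2) by (simpl; ring). rewrite <- mult_INR.
        apply le_INR. lia. }
    specialize (Hge1 N ltac:(lia)).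
    eapply Rle_trans; [apply Rabs_triang|].
    eapply Rle_trans; [apply Rplus_le_compat_r, Rabs_triang|].
    nra.
Qed.

Lemma length_filter_seq (p : nat -> bool) (a n : nat) :
  INR (length (filter p (seq a n))) = rsum n (fun i => indic (p (a + i)%nat)).
Proof.
  revert a. induction n as [|n IH]; intros a; [reflexivity|].
  rewrite seq_S, filter_app, length_app, plus_INR, IH. simpl.
  destruct (p (a + n)%nat); simpl; ring.
Qed.

Lemma congZb_mod (s m : nat) (l : Z) : (1 <= m)%nat ->
  congZb s l m = Nat.eqb (s mod m) (Z.to_nat (l mod Z.of_nat m)).
Proof.
  intros Hm. unfold congZb.
  pose proof (Z.mod_pos_bound l (Z.of_nat m) ltac:(lia)) as Hb.
  set (r := (l mod Z.of_nat m)%Z) in *.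
  assert (E : ((Z.of_nat s - l) mod Z.of_nat m = (Z.of_nat (s mod m) - r) mod Z.of_nat m)%Z).
  { unfold r. rewrite Nat2Z.inj_mod. apply Zminus_mod. }
  rewrite E. pose proof (Nat.mod_upper_bound s m ltac:(lia)).
  destruct (Nat.eqb_spec (s mod m) (Z.to_nat r)) as [H1|H1].
  - replace (Z.of_nat (s mod m) - r)%Z with 0%Z by lia. rewrite Zmod_0_l. reflexivity.
  - apply Z.eqb_neq. intros H2. apply Z.mod_divide in H2; [|lia]. destruct H2 as [k Hk].
    assert (k = 0)%Z by nia. lia.
Qed.

Theorem theorem3 (q1 q2 m1 m2 : nat) (l1 l2 : Z) (c : R) :
  (2 <= q1)%nat -> (2 <= q2)%nat -> (1 <= m1)%nat -> (1 <= m2)%nat ->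
  Nat.gcd q1 q2 = 1%nat -> Nat.gcd m1 (q1 - 1) = 1%nat -> Nat.gcd m2 (q2 - 1) = 1%nat ->
  1 < c < 18 / 17 ->
  exists eps : R, 0 < eps /\
    exists C : R, forall x : R, 1 <= x ->
      Rabs (INR (count_set q1 q2 m1 m2 l1 l2 c x) - x / (INR m1 * INR m2))
        <= C * Rpower x (1 - eps).
Proof.
  intros Hq1 Hq2 Hm1 Hm2 Hq Hg1 Hg2 Hc.
  set (r1 := Z.to_nat (l1 mod Z.of_nat m1)). set (r2 := Z.to_nat (l2 mod Z.of_nat m2)).
  pose proof (Z.mod_pos_bound l1 (Z.of_nat m1) ltac:(lia)) as Hb1.
  pose proof (Z.mod_pos_bound l2 (Z.of_nat m2) ltac:(lia)) as Hb2.
  set (l := (r1 * m2 + r2)%nat).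
  assert (Hr1 : (r1 < m1)%nat) by (unfold r1; lia).
  assert (Hr2 : (r2 < m2)%nat) by (unfold r2; lia).
  assert (Hl : (l < m1 * m2)%nat) by (unfold l; nia).
  assert (Hm1' : 1 <= INR m1) by (apply (le_INR 1); lia).
  assert (Hm2' : 1 <= INR m2) by (apply (le_INR 1); lia).
  set (w := INR m1 * INR m2). assert (Hw : 1 <= w) by (unfold w; nra).
  assert (Hiw : 0 < / w <= 1).
  { split; [apply Rinv_0_lt_compat; lra|]. rewrite <- Rinv_1. apply Rinv_le_contravar; lra. }
  destruct (dyadic_discrepancy c q1 q2 m1 m2 l Hc Hq1 Hq2 Hm1 Hm2 Hq Hg1 Hg2 Hl)
    as [eps [C [Heps [HC Hblock]]]].
  (* The constant of [dyadic_sum] doubles because its range has length [1 + X], at most 2x; the 2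
     covers the rounding of [x] and the term at 0. *)
  exists eps. split; [lra|]. exists (6 * (C + 1) + 2). intros x Hx.
  set (p := fun n => congZb (digit_sum q1 (floor_pow n c)) l1 m1 &&
                     congZb (digit_sum q2 (floor_pow n c)) l2 m2).
  set (f := fun n => indic (p n) - / w).
  assert (Hp : forall n, p n = Nat.eqb (digit_class q1 q2 m1 m2 (nfloor (npow c n))) l).
  { intros n. unfold p. rewrite !congZb_mod by assumption. fold r1 r2.
    change (floor_pow n c) with (nfloor (npow c n)). unfold digit_class, l.
    set (y := nfloor (npow c n)).
    pose proof (Nat.mod_upper_bound (digit_sum q2 y) m2 ltac:(lia)).
    destruct (Nat.eqb_spec (digit_sum q1 y mod m1) r1) as [A|A],
      (Nat.eqb_spec (digit_sum q2 y mod m2) r2) as [B|B];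
    destruct (Nat.eqb_spec (digit_sum q1 y mod m1 * m2 + digit_sum q2 y mod m2) (r1 * m2 + r2)) as [D|D];
      simpl; try reflexivity; exfalso.
    - apply D. congruence.
    - apply pair_code_inj in D; [|assumption|assumption]. tauto.
    - apply pair_code_inj in D; [|assumption|assumption]. tauto.
    - apply pair_code_inj in D; [|assumption|assumption]. tauto. }
  assert (Hf : forall n, Rabs (f n) <= 1).
  { intros n. unfold f. pose proof (indic_bounds (p n)). apply Rabs_le. lra. }
  assert (Hfb : forall N, (0 < N)%nat ->
    Rabs (rsum N (fun n => f (N + n)%nat)) <= C * Rpower (INR N) (1 - eps)).
  { intros N HN. unfold f. rewrite rsum_minus, rsum_const.
    rewrite (rsum_ext N _ (fun n => indic (Nat.eqb (digit_class q1 q2 m1 m2 (nfloor (npow c (N + n)))) l)))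
      by (intros; rewrite Hp; reflexivity).
    apply Hblock. exact HN. }
  set (X := nfloor x). destruct (nfloor_half x Hx) as [_ HX1]. fold X in HX1.
  destruct (nfloor_spec x ltac:(lra)) as [HXa HXb]. fold X in HXa, HXb.
  (* [rsum] starts at 0 and the count at 1, so the value at 0 is taken out again. *)
  assert (Hcount : INR (count_set q1 q2 m1 m2 l1 l2 c x) = rsum (1 + X) f + (INR X + 1) * / w - indic (p 0%nat)).
  { unfold count_set. change (Z.to_nat (Rfloor x)) with X. fold p. rewrite length_filter_seq.
    unfold f. rewrite rsum_minus, rsum_const, rsum_app. rewrite plus_INR. simpl (INR 1). simpl rsum at 2.
    ring. }
  rewrite Hcount.
  assert (HS := dyadic_sum f eps C Heps HC Hf Hfb (1 + X)%nat ltac:(lia)).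
  assert (HX2 : Rpower (INR (1 + X)) (1 - eps) <= 2 * Rpower x (1 - eps)).
  { apply Rle_trans with (Rpower (2 * x) (1 - eps)).
    - apply Rle_Rpower_l; [lra|]. split; [apply lt_0_INR; lia|]. rewrite plus_INR. simpl (INR 1). lra.
    - rewrite <- Rpower_mult_distr by lra. apply Rmult_le_compat_r; [left; apply Rpower_pos|].
      rewrite <- (Rpower_1 2) at 2 by lra. apply Rle_Rpower; lra. }
  assert (H1 : 1 <= Rpower x (1 - eps)).
  { rewrite <- (Rpower_O x) at 1 by lra. apply Rle_Rpower; lra. }
  replace (rsum (1 + X) f + (INR X + 1) * / w - indic (p 0%nat) - x / w) with
    (rsum (1 + X) f + ((INR X + 1 - x) * / w - indic (p 0%nat))) by (unfold Rdiv; ring).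
  eapply Rle_trans; [apply Rabs_triang|].
  assert (Hrest : Rabs ((INR X + 1 - x) * / w - indic (p 0%nat)) <= 2).
  { pose proof (indic_bounds (p 0%nat)).
    assert (0 <= (INR X + 1 - x) * / w <= 1) by (split; [apply Rmult_le_pos; lra|nra]).
    apply Rabs_le. lra. }
  assert (3 * (C + 1) * Rpower (INR (1 + X)) (1 - eps) <= 3 * (C + 1) * (2 * Rpower x (1 - eps))).
  { apply Rmult_le_compat_l; lra. }
  lra.
Qed.
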